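(* Let $S$ be a closed, densely defined, symmetric operator in a separable Hilbert space $\mathcal H$, let $\{\mathcal G,\Gamma_0,\Gamma_1\}$ be a quasi boundary triple for $\overline T=S^*$ with corresponding $\gamma$-field $\gamma$ and Weyl function $M$, let $A_0=T\upharpoonright\ker\Gamma_0$ and let $E(\cdot)$ be the spectral measure of $A_0$. Let $\Delta\subset\mathbb R$ be an open interval such that $$E(\Delta)\mathcal H=\operatorname{clsp}\{E(\Delta)\gamma(\nu)g:\nu\in\mathbb C\setminus\mathbb R,\ g\in\operatorname{ran}\Gamma_0\}.$$ Then the following assertions hold for each $\lambda\in\Delta$. (i) $\lambda\in\rho(A_0)$ if and only if $M$ can be continued analytically into $\lambda$. (ii) $\lambda\in\sigma_{\rm c}(A_0)$ if and only if $\text{s-}\lim_{\eta\searrow0}i\eta M(\lambda+i\eta)=0$ and $M$ cannot be continued analytically into $\lambda$. If $S$ is simple, then (i) and (ii) hold for all $\lambda\in\mathbb R$.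
   Context: Quasi boundary triple: let $S$ be a closed, densely defined, symmetric operator in a separable Hilbert space $\mathcal H$ and let $T\subset S^*$ be an operator with $\overline T=S^*$. A triple $\{\mathcal G,\Gamma_0,\Gamma_1\}$ consisting of a Hilbert space $\mathcal G$ and two linear mappings $\Gamma_0,\Gamma_1:\operatorname{dom}T\to\mathcal G$ is a quasi boundary triple for $S^*$ if (1) the range of $(\Gamma_0,\Gamma_1)^\top:\operatorname{dom}T\to\mathcal G\times\mathcal G$ is dense; (2) $(Tu,v)_{\mathcal H}-(u,Tv)_{\mathcal H}=(\Gamma_1u,\Gamma_0v)_{\mathcal G}-(\Gamma_0u,\Gamma_1v)_{\mathcal G}$ for all $u,v\in\operatorname{dom}T$; (3) $A_0:=T\upharpoonright\ker\Gamma_0$ is selfadjoint in $\mathcal H$. For $\lambda\in\rho(A_0)$ one has $\operatorname{dom}T=\ker\Gamma_0\dotplus\ker(T-\lambda)$; the $\gamma$-field and Weyl function are $\gamma(\lambda)=(\Gamma_0\upharpoonright\ker(T-\lambda))^{-1}$ and $M(\lambda)=\Gamma_1\gamma(\lambda)$, both defined on the dense subspace $\operatorname{ran}\Gamma_0$ of $\mathcal G$. $\operatorname{clsp}$ denotes the closed linear span; s-$\lim$ is the strong limit (on $\operatorname{ran}\Gamma_0$). $S$ is simple (completely non-selfadjoint) if there is no nontrivial $S$-invariant subspace of $\mathcal H$ which reduces $S$ to a selfadjoint operator; equivalently $\mathcal H=\operatorname{clsp}\{\gamma(\nu)g:\nu\in\mathbb C\setminus\mathbb R,\ g\in\operatorname{ran}\Gamma_0\}$.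 $M$ can be continued analytically into $\lambda\in\mathbb R$ if there is an open neighborhood $\mathcal O$ of $\lambda$ in $\mathbb C$ such that $\zeta\mapsto M(\zeta)g$ can be continued analytically to $\mathcal O$ for all $g\in\operatorname{ran}\Gamma_0$. $\sigma_{\rm c}(A_0)=\sigma(A_0)\setminus\sigma_{\rm p}(A_0)$ is the continuous spectrum, where $\sigma_{\rm p}$ denotes the set of eigenvalues. *)

(* Defs.v *)
From HB Require Import structures.
From mathcomp Require Import all_boot all_order all_algebra.
From mathcomp Require Import sesquilinear complex.
From mathcomp Require Import all_classical all_reals all_analysis.

Set Implicit Arguments.
Unset Strict Implicit.
Unset Printing Implicit Defensive.

Import Order.TTheory GRing.Theory Num.Theory.
Import numFieldNormedType.Exports.

Local Open Scope classical_set_scope.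
Local Open Scope complex_scope.
Local Open Scope ring_scope.

Section Operators.
Context {K : nzRingType}.

Definition linear_subspace (V : lmodType K) (L : set V) :=
  L 0 /\ forall (a : K) (u v : V), L u -> L v -> L (a *: u + v).

(* A linear operator with domain op_dom; the values of opfun outside op_dom
   carry no information. *)
Record linop (U V : lmodType K) := Linop {
  op_dom : set U ;
  opfun :> U -> V ;
  dom_subspace : linear_subspace op_dom ;
  opfun_linear : forall (a : K) (u v : U), op_dom u -> op_dom v ->
    opfun (a *: u + v) = a *: opfun u + opfun v }.

Definition op_ker (U V : lmodType K) (A : linop U V) : set U :=
  [set u | op_dom A u /\ A u = 0].

Definition op_ran (U V : lmodType K) (A : linop U V) : set V := A @` op_dom A.

Definition op_graph (U V : lmodType K) (A : linop U V) : set (U * V) :=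
  [set p | op_dom A p.1 /\ A p.1 = p.2].

Lemma ker_subspace (U V : lmodType K) (A : linop U V) : linear_subspace (op_ker A).
Proof.
have [A0 Alin] := dom_subspace A; split.
  split=> //; have := opfun_linear (-1) A0 A0.
  by rewrite scaler0 addr0 scaleN1r addNr.
move=> a u v [Au u0] [Av v0]; split; first exact: Alin.
by rewrite opfun_linear// u0 v0 scaler0 addr0.
Qed.

Section Restrict.
Variables (U V : lmodType K) (A : linop U V) (L : set U).
Hypothesis subL : linear_subspace L.

Lemma restrict_subspace : linear_subspace (op_dom A `&` L).
Proof.
have [A0 Alin] := dom_subspace A; have [L0 Llin] := subL.
split=> // a u v [Au Lu] [Av Lv]; split; [exact: Alin|exact: Llin].
Qed.

Lemma restrict_linear (a : K) (u v : U) :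
  (op_dom A `&` L) u -> (op_dom A `&` L) v -> A (a *: u + v) = a *: A u + A v.
Proof. by move=> [Au _] [Av _]; exact: opfun_linear. Qed.

Definition op_restrict : linop U V := Linop restrict_subspace restrict_linear.
End Restrict.

End Operators.

Section ShiftedOperator.
Context {K : comNzRingType} (U : lmodType K) (A : linop U U) (l : K).

Lemma op_shift_linear (a : K) (u v : U) : op_dom A u -> op_dom A v ->
  A (a *: u + v) - l *: (a *: u + v) =
  a *: (A u - l *: u) + (A v - l *: v).
Proof.
move=> Au Av; rewrite opfun_linear// scalerDr scalerBr !scalerA (mulrC l a).
by rewrite opprD addrACA.
Qed.

(* A - l, with the domain of A *)
Definition op_shift : linop U U := Linop (dom_subspace A) op_shift_linear.
End ShiftedOperator.

Definition separable_space (X : topologicalType) :=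
  exists2 D : set X, countable D & dense D.

Section HilbertSpace.
Context {R : realType} {H : completeNormedModType R[i]}.
Implicit Types (ip : {dot H for Num.conj}) (A : linop H H) (L : set H).

Definition clsp (X : set H) : set H :=
  closure [set v | exists n (c : 'I_n -> R[i]) (x : 'I_n -> H),
    (forall k, X (x k)) /\ v = \sum_k c k *: x k].

(* The graph of the adjoint; it is the graph of an operator exactly when A is
   densely defined. *)
Definition adjoint ip A : set (H * H) :=
  [set p | forall u, op_dom A u -> ip (A u) p.1 = ip u p.2].

Definition symmetric_op ip A := op_graph A `<=` adjoint ip A.

Definition selfadjoint ip A := dense (op_dom A) /\ adjoint ip A = op_graph A.

(* A is selfadjoint as an operator in the Hilbert space L: the intersection
   with L * L is the graph of the adjoint taken in L. *)
Definition selfadjoint_in ip L A :=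
  [/\ op_dom A `<=` L, op_ran A `<=` L, L `<=` closure (op_dom A) &
      adjoint ip A `&` (L `*` L) = op_graph A].

Definition is_projection ip L (u v : H) :=
  L v /\ forall w, L w -> ip (u - v) w = 0.

(* For L closed with orthogonal projection P, this is: P u is in the domain of
   A and A P u = P A u, for all u in the domain of A. *)
Definition reduces ip L A := forall u v, op_dom A u -> is_projection ip L u v ->
  op_dom A v /\ is_projection ip L (A u) (A v).

(* L = H is allowed: a selfadjoint operator in H <> 0 is not simple. *)
Definition simple_op ip A := forall L (subL : linear_subspace L), closed L ->
  (forall u, op_dom A u -> L u -> L (A u)) ->
  reduces ip L A -> selfadjoint_in ip L (op_restrict A subL) -> L = [set 0].

Definition resolvent_set A : set R[i] :=
  [set l | set_bij (op_dom A) setT (op_shift A l) /\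
    exists c : R[i], forall u, op_dom A u -> `|u| <= c * `|op_shift A l u|].

Definition spectrum A : set R[i] := ~` resolvent_set A.

Definition point_spectrum A : set R[i] :=
  [set l | exists2 u, op_ker (op_shift A l) u & u != 0].

Definition continuous_spectrum A : set R[i] := spectrum A `\` point_spectrum A.

(* For a projection-valued measure E, (E(B)u, u) = |E(B)u|^2 is real and
   defines a finite measure on the Borel sets. *)
Definition scalar_measure ip (E : set R -> {linear H -> H}) (u : H) :
  set (measurableTypeR R) -> \bar R := fun B => (complex.Re (ip (E B u) u))%:E.

(* E is a projection-valued measure on the Borel sets and A is the integral of
   t with respect to E, expressed by
   dom A = {u | int t^2 d(E(t)u, u) < oo}, (Au, u) = int t d(E(t)u, u);
   by polarization the second identity determines A on its domain.
   E(0) = 0 and E(B)E(C) = E(B & C) follow from the other properties. *)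
Record spectral_measure ip A (E : set R -> {linear H -> H}) := {
  spectral_idempotent : forall (B : set (measurableTypeR R)), measurable B ->
    forall u, E B (E B u) = E B u ;
  spectral_symmetric : forall (B : set (measurableTypeR R)), measurable B ->
    forall u v, ip (E B u) v = ip u (E B v) ;
  spectral_setT : forall u, E setT u = u ;
  spectral_sigma_additive : forall F : (set (measurableTypeR R))^nat,
    (forall n, measurable (F n)) -> trivIset setT F -> forall u,
    series (fun n => E (F n) u) @ \oo --> E (\bigcup_n F n) u ;
  spectral_dom : op_dom A =
    [set u | (\int[scalar_measure ip E u]_t ((t ^+ 2)%:E) < +oo)%E] ;
  spectral_integral : forall u, op_dom A u ->
    ip (A u) u = (fine (\int[scalar_measure ip E u]_t (t%:E))%E)%:C }.

End HilbertSpace.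

Section BoundaryTriple.
Context {R : realType} {H G : completeNormedModType R[i]}.
Implicit Types (ipH : {dot H for Num.conj}) (ipG : {dot G for Num.conj}).
Implicit Types (S T : linop H H) (Gam : linop H G).

Definition A_0 T Gam0 : linop H H := op_restrict T (ker_subspace Gam0).

Record quasi_boundary_triple ipH ipG S T Gam0 Gam1 := {
  qbt_sub : op_graph T `<=` adjoint ipH S ;
  qbt_closure : closure (op_graph T) = adjoint ipH S ;
  qbt_dom0 : op_dom Gam0 = op_dom T ;
  qbt_dom1 : op_dom Gam1 = op_dom T ;
  qbt_dense : dense ((fun u => (Gam0 u, Gam1 u)) @` op_dom T) ;
  qbt_green : forall u v, op_dom T u -> op_dom T v ->
    ipH (T u) v - ipH u (T v) = ipG (Gam1 u) (Gam0 v) - ipG (Gam0 u) (Gam1 v) ;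
  qbt_selfadjoint : selfadjoint ipH (A_0 T Gam0) }.

(* Gam0 is injective on ker (T - l) for l in the resolvent set of A_0; the
   inverse is extended by 0 outside ran Gam0. *)
Definition gamma_field T Gam0 (l : R[i]) : G -> H :=
  'pinv_(fun=> 0) (op_ker (op_shift T l)) Gam0.

Definition weyl T Gam0 Gam1 (l : R[i]) (g : G) : G := Gam1 (gamma_field T Gam0 l g).

(* R[i]^o is R[i] as a normed space over itself, so derivability in the
   direction 1 is complex differentiability. *)
Definition analytic_on (O : set R[i]^o) (F : R[i]^o -> G) :=
  forall z, O z -> derivable F z 1.

(* The domain of definition of the Weyl function is the resolvent set of A_0. *)
Definition weyl_continuable T Gam0 Gam1 (l : R) :=
  exists O : set R[i]^o, [/\ open O, O l%:C &
    forall g, op_ran Gam0 g -> exists F : R[i]^o -> G, analytic_on O F /\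
      forall z, O z -> resolvent_set (A_0 T Gam0) z -> F z = weyl T Gam0 Gam1 z g].

Definition weyl_slim0 T Gam0 Gam1 (l : R) := forall g, op_ran Gam0 g ->
  (0 +i* eta)%C *: weyl T Gam0 Gam1 (l +i* eta)%C g @[eta --> 0^'+] --> 0.

End BoundaryTriple.

(* Main.v *)
Require Import Defs.
From HB Require Import structures.
From mathcomp Require Import all_boot all_order all_algebra.
From mathcomp Require Import sesquilinear complex ring lra.
From mathcomp Require Import all_classical all_reals all_analysis measurable_realfun.

(** If M continues analytically across s, then eta |gamma(s + i eta) g|^2 =
    Im (M(s + i eta) g, g) is O(eta), because M(conj z) is adjoint to M(z); so
    gamma(s + i eta) g stays bounded as eta decreases to 0.  Since gamma(nu) =
    (A_0 - s - i eta) R(nu) gamma(s + i eta), the mass of gamma(nu) g on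
    [s - eta, s + eta] is then O(eta^2), and a measure with this property at
    every point of an interval vanishes there by bisection.  Hence E vanishes
    near lambda, which gives (i) without Stone's formula.  For (ii), an
    eigenvector u at lambda satisfies (Gam1 u, g) = i eta (u, gamma(lambda + i eta) g),
    and eta^2 |gamma(lambda + i eta) g|^2 = eta Im (M(lambda + i eta) g, g) tends
    to 0 when the strong limit is 0; then u is orthogonal to every gamma(nu) g.
    Conversely, if lambda is not an eigenvalue then eta R(lambda + i eta) tends to 0
    strongly.  If S is simple, the orthogonal complement of all gamma(nu) g reduces
    S to a selfadjoint operator and so is trivial, and Delta = R is admissible. *)

Set Implicit Arguments.
Unset Strict Implicit.
Unset Printing Implicit Defensive.

Import Order.TTheory GRing.Theory Num.Theory.
Import numFieldNormedType.Exports.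

Local Open Scope classical_set_scope.
Local Open Scope complex_scope.
Local Open Scope ring_scope.

(** * Hilbert spaces over R[i] *)

(** The spectral measure is given only through the domain and the quadratic form of A_0, so no
    functional calculus is at hand. It is replaced by two facts: E commutes with A_0, by
    polarization, and A_0 - s is estimated on spectral subspaces through its form. The resolvent set
    is tested by a lower bound on A_0 - z.

    The continuation of M is given for each g separately, and the bound it yields on gamma(s + i
    eta) g depends on g and s, without uniformity in s. This rules out integrating over an interval,
    whereas bisection needs a single bad point. One function F agrees with M above and below s, so
    F(s) cancels in M(s - i eta) g - M(s + i eta) g, and derivability at s makes this difference
    O(eta).

    gamma(z) lives on a dense subspace only. Its boundedness comes from Gam1 R(z) being adjoint to
    gamma(conj z), together with uniform boundedness.

    Both generation hypotheses enter in one form: a vector in ran E(Delta) orthogonal to every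
    gamma(nu) g is zero. *)

Section ComplexAbs.
Context {R : realType}.
Implicit Types (a b : R[i]).

(** Norms on R[i]-spaces take values in R[i]. [cabs], [rnorm] and [rip] move estimates to the
    ordered field R, where [lra] and [nra] apply. *)
Definition cabs a : R := complex.Re `|a|.

Lemma cabsE a : `|a| = (cabs a)%:C.
Proof. by rewrite /cabs RRe_real// ger0_real. Qed.

Lemma cabs_ge0 a : 0 <= cabs a.
Proof. by rewrite -ler0c -cabsE. Qed.

Lemma cabsR (x : R) : cabs x%:C = `|x|.
Proof. by rewrite /cabs normc_def/= expr0n/= addr0 sqrtr_sqr. Qed.

Lemma cabs2 a : cabs a ^+ 2 = complex.Re a ^+ 2 + complex.Im a ^+ 2.
Proof. by apply: complexI; rewrite add_Re2_Im2 cabsE rmorphXn. Qed.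

Lemma gt0_complex a : 0 < a -> 0 < complex.Re a /\ (complex.Re a)%:C = a.
Proof.
move=> a0; have h : (complex.Re a)%:C = a; first by rewrite RRe_real// ger0_real// ltW.
by rewrite -ltcR h.
Qed.

Lemma cabs_i (x : R) : cabs (0 +i* x)%C = `|x|.
Proof.
apply/eqP; rewrite -(@eqrXn2 _ 2) ?cabs_ge0// cabs2/= expr0n add0r.
by rewrite real_normK ?num_real.
Qed.

Lemma complex_line (x y : R) : (x +i* y)%C = x%:C + (0 +i* y)%C.
Proof. by apply/eqP; rewrite eq_complex/= addr0 add0r !eqxx. Qed.

Lemma conjCE a : Num.conj a = (complex.Re a -i* complex.Im a)%C.
Proof. by case: a. Qed.

End ComplexAbs.

Section RealNorm.
Context {R : realType} {H : normedModType R[i]}.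
Implicit Types (u v : H) (a : R[i]).

Definition rnorm u : R := complex.Re `|u|.

Lemma normE u : `|u| = (rnorm u)%:C.
Proof. by rewrite /rnorm RRe_real// ger0_real. Qed.

Lemma rnorm_ge0 u : 0 <= rnorm u.
Proof. by rewrite -ler0c -normE. Qed.

Lemma rnorm0 : rnorm 0 = 0.
Proof. by rewrite /rnorm normr0. Qed.

Lemma rnorm0_eq0 u : rnorm u = 0 -> u = 0.
Proof. by move=> u0; apply/normr0_eq0; rewrite normE u0. Qed.

Lemma rnormN u : rnorm (- u) = rnorm u.
Proof. by rewrite /rnorm normrN. Qed.

Lemma rnormB u v : rnorm (u - v) = rnorm (v - u).
Proof. by rewrite -opprB rnormN. Qed.

Lemma rnorm_triangle u v : rnorm (u + v) <= rnorm u + rnorm v.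
Proof. by rewrite -lecR rmorphD/= -!normE ler_normD. Qed.

Lemma rnormZ a u : rnorm (a *: u) = cabs a * rnorm u.
Proof. by apply: complexI; rewrite -normE normrZ cabsE normE -rmorphM. Qed.

Lemma rnormZR (x : R) u : rnorm (x%:C *: u) = `|x| * rnorm u.
Proof. by rewrite rnormZ cabsR. Qed.

Lemma rnorm_small u : (forall e, 0 < e -> rnorm u <= e) -> u = 0.
Proof.
move=> usmall; apply/rnorm0_eq0/eqP; rewrite eq_le rnorm_ge0 andbT.
by apply/ler_addgt0Pr => e e0; rewrite add0r usmall.
Qed.

Lemma closure_rnormP (L : set H) u :
  closure L u <-> forall e : R, 0 < e -> exists2 v, L v & rnorm (u - v) < e.
Proof.
split.
  move=> Lu e e0; have : nbhs u (ball u e%:C).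
    by apply: nbhsx_ballx; rewrite ltcE/= eqxx.
  move=> /Lu[v [Lv]]; rewrite -ball_normE/= normE ltcR => ve.
  by exists v.
move=> Lu B /nbhs_ballP[e /= e0 eB].
have ere : e = (complex.Re e)%:C by rewrite RRe_real// ger0_real// ltW.
have [|v Lv uv] := Lu (complex.Re e); first by rewrite -ltcR -ere.
exists v; split => //; apply: eB.
by rewrite -ball_normE/= normE ere ltcR.
Qed.

Lemma closed_rnorm (L : set H) u : closed L ->
  (forall e : R, 0 < e -> exists2 v, L v & rnorm (u - v) < e) -> L u.
Proof. by move=> cL /closure_rnormP/cL. Qed.

Lemma dense_rnormP (D : set H) : dense D <->
  forall u (e : R), 0 < e -> exists2 v, D v & rnorm (u - v) < e.
Proof.
split=> [dD u e e0|dD].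
  have e0' : 0 < e%:C by rewrite ltcE/= eqxx.
  have [||v [uv Dv]] := dD (ball u e%:C)°.
  - by exists u; exact: nbhsx_ballx.
  - exact: open_interior.
  - exists v => //; have := interior_subset uv.
    by rewrite -ball_normE/= normE ltcR.
move=> O [u Ou] oO; have : closure D u by apply/closure_rnormP; exact: dD.
move=> /(_ O)[|v [Dv Ov]]; first exact: open_nbhs_nbhs.
by exists v.
Qed.

End RealNorm.

Section Hilbert.
Context {R : realType} {H : completeNormedModType R[i]}.
Variables (ip : {dot H for Num.conj}).
Hypothesis ip_norm : forall u : H, `|u| ^+ 2 = ip u u.
Implicit Types (u v w : H) (a : R[i]).

Lemma ipDl u v w : ip (u + v) w = ip u w + ip v w. Proof. exact: linearDl. Qed.
Lemma ipBl u v w : ip (u - v) w = ip u w - ip v w. Proof. exact: linearBl. Qed.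
Lemma ipDr u v w : ip w (u + v) = ip w u + ip w v. Proof. exact: linearDr. Qed.
Lemma ipBr u v w : ip w (u - v) = ip w u - ip w v. Proof. exact: linearBr. Qed.
Lemma ip0l u : ip 0 u = 0. Proof. exact: linear0l. Qed.
Lemma ip0r u : ip u 0 = 0. Proof. exact: linear0r. Qed.
Lemma ipZl a u v : ip (a *: u) v = a * ip u v. Proof. exact: linearZl_LR. Qed.
Lemma ipZr a u v : ip u (a *: v) = Num.conj a * ip u v.
Proof. exact: linearZr_LR. Qed.
Lemma ipC u v : ip u v = Num.conj (ip v u).
Proof. by rewrite hermC/= expr0 mul1r. Qed.

Definition rip u v : R := complex.Re (ip u v).

Lemma ripC u v : rip u v = rip v u.
Proof. by rewrite /rip ipC conjCE. Qed.

Lemma ripDl u v w : rip (u + v) w = rip u w + rip v w.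
Proof. by rewrite /rip ipDl raddfD. Qed.

Lemma ripBl u v w : rip (u - v) w = rip u w - rip v w.
Proof. by rewrite /rip ipBl raddfB. Qed.

Lemma ripNl u v : rip (- u) v = - rip u v.
Proof. by rewrite /rip linearNl raddfN. Qed.

Lemma ripDr u v w : rip u (v + w) = rip u v + rip u w.
Proof. by rewrite /rip ipDr raddfD. Qed.

Lemma ripBr u v w : rip u (v - w) = rip u v - rip u w.
Proof. by rewrite /rip ipBr raddfB. Qed.

Lemma ripZl (a : R) u v : rip (a%:C *: u) v = a * rip u v.
Proof. by rewrite /rip ipZl; case: (ip u v) => x y /=; rewrite mul0r subr0. Qed.

Lemma ripZr (a : R) u v : rip u (a%:C *: v) = a * rip u v.
Proof. by rewrite ripC ripZl ripC. Qed.

Lemma ip_rip u v : ip u v = (rip u v +i* rip u ('i%C *: v))%C.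
Proof.
rewrite /rip ipZr conjCE; case: (ip u v) => x y /=.
by rewrite !mul0r mulN1r opprK add0r.
Qed.

Lemma rip_self u : rip u u = rnorm u ^+ 2.
Proof. by rewrite /rip -ip_norm normE -rmorphXn. Qed.

Lemma ip_self u : ip u u = (rnorm u ^+ 2)%:C.
Proof. by rewrite -ip_norm normE rmorphXn. Qed.

Lemma rnormD2 u v : rnorm (u + v) ^+ 2 = rnorm u ^+ 2 + 2 * rip u v + rnorm v ^+ 2.
Proof. by rewrite -!rip_self ripDl !ripDr (ripC v u); ring. Qed.

Lemma rnormB2 u v : rnorm (u - v) ^+ 2 = rnorm u ^+ 2 - 2 * rip u v + rnorm v ^+ 2.
Proof. by rewrite -!rip_self ripBl !ripBr (ripC v u); ring. Qed.

Lemma parallelogram u v :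
  rnorm (u + v) ^+ 2 + rnorm (u - v) ^+ 2 = 2 * (rnorm u ^+ 2 + rnorm v ^+ 2).
Proof. by rewrite rnormD2 rnormB2; ring. Qed.

(** The multiples by 1 and i recover the real and the imaginary part. Orthogonality can thus be
    proved by real estimates, with the scalar absorbed into the second vector. *)
Lemma ip_orth u v :
  (forall a, rip u (a *: v) = 0) -> ip u v = 0.
Proof.
by move=> uv0; rewrite ip_rip uv0 -[X in rip u X]scale1r uv0.
Qed.

Lemma rip_le u v : rip u v <= rnorm u * rnorm v.
Proof.
have [v0|v0] := eqVneq (rnorm v) 0.
  by rewrite (rnorm0_eq0 v0) rnorm0 mulr0 /rip ip0r.
have [u0|u0] := eqVneq (rnorm u) 0.
  by rewrite (rnorm0_eq0 u0) rnorm0 mul0r /rip ip0l.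
have up : 0 < rnorm u by rewrite lt_def u0 rnorm_ge0.
have vp : 0 < rnorm v by rewrite lt_def v0 rnorm_ge0.
(* The squared norm of |v| u - |u| v equals 2 |u| |v| (|u| |v| - Re (u, v)). *)
have := sqr_ge0 (rnorm ((rnorm v)%:C *: u - (rnorm u)%:C *: v)).
rewrite rnormB2 ripZl ripZr !rnormZR.
rewrite !ger0_norm ?rnorm_ge0// => h.
have {h} : 0 <= (2 * (rnorm u * rnorm v)) * (rnorm u * rnorm v - rip u v) by lra.
by rewrite pmulr_rge0 ?subr_ge0// !mulr_gt0.
Qed.

Lemma normr_rip_le u v : `|rip u v| <= rnorm u * rnorm v.
Proof.
rewrite ler_norml rip_le andbT lerNl -(rnormN u).
by apply: le_trans (rip_le _ _); rewrite /rip linearNl raddfN.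
Qed.

Lemma ip0P u v : ip u v = 0 -> rip u v = 0.
Proof. by rewrite /rip => ->. Qed.

Lemma pythagoras u v : ip u v = 0 -> rnorm (u + v) ^+ 2 = rnorm u ^+ 2 + rnorm v ^+ 2.
Proof. by move=> /ip0P uv; rewrite rnormD2 uv mulr0 addr0. Qed.

Lemma ip_eq0C u v : ip u v = 0 -> ip v u = 0.
Proof. by move=> uv0; rewrite ipC uv0 conjCE/= oppr0. Qed.

Lemma ip_self0 u : ip u u = 0 -> u = 0.
Proof.
move=> uu0; apply: rnorm0_eq0; have := rip_self u; rewrite /rip uu0/= => /esym/eqP.
by rewrite sqrf_eq0 => /eqP.
Qed.

Lemma ip_dense0 (D : set H) u : dense D -> (forall v, D v -> ip u v = 0) -> u = 0.
Proof.
move=> /dense_rnormP dD uD0; apply: rnorm_small => e e0.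
have [v Dv uv] := dD u e e0; have : rnorm u ^+ 2 <= rnorm u * e.
  rewrite -rip_self -[X in rip u X](subrK v) ripDr (ip0P (uD0 _ Dv)) addr0.
  by rewrite (le_trans (rip_le _ _))// ler_wpM2l ?rnorm_ge0// ltW.
have := rnorm_ge0 u; rewrite le_eqVlt => /predU1P[<- _|u0]; first exact: ltW.
by rewrite expr2 ler_pM2l.
Qed.

Lemma closure_orth (X : set H) u v : closure X u ->
  (forall w, X w -> ip v w = 0) -> ip v u = 0.
Proof.
move=> /closure_rnormP Xu vX; apply: ip_orth => a; apply/eqP; rewrite -normr_le0.
apply/ler_addgt0Pr => e e0; rewrite add0r.
pose c : R := (cabs a + 1) * (rnorm v + 1).
have a0 := cabs_ge0 a; have v0 := rnorm_ge0 v.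
have c0 : 0 < c by rewrite mulr_gt0// ltr_pwDr.
have [w Xw] := Xu (e / c) (divr_gt0 e0 c0).
rewrite ltr_pdivlMr// /c => uw.
rewrite -(subrK w u) scalerDr ripDr [X in _ + X]ip0P ?addr0; last first.
  by rewrite ipZr vX ?mulr0.
rewrite (le_trans (normr_rip_le _ _))// rnormZ.
by have := rnorm_ge0 (u - w); nra.
Qed.

End Hilbert.

(** * Completeness and orthogonal projection *)

Section Completeness.
Context {R : realType} {H : completeNormedModType R[i]}.
Variables (ip : {dot H for Num.conj}).
Hypothesis ip_norm : forall u : H, `|u| ^+ 2 = ip u u.
Implicit Types (u v w f : H) (a : R[i]) (L : set H).
Local Notation rip := (rip ip).

Lemma invS_lt (e : R) : 0 < e -> exists N : nat, forall n, (N <= n)%N -> n.+1%:R^-1 < e.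
Proof.
move=> e0; have [N _ NP] := near_infty_natSinv_lt (PosNum e0).
by exists N => n Nn; exact: NP.
Qed.

Lemma rnorm_complete (u : nat -> H) :
  (forall e : R, 0 < e -> exists N, forall m n, (N <= m)%N -> (N <= n)%N ->
    rnorm (u m - u n) < e) ->
  exists l, forall e : R, 0 < e -> exists N, forall n, (N <= n)%N -> rnorm (u n - l) < e.
Proof.
move=> uC; have /cvg_ex[l ul] : cvg (u @ \oo).
  apply: cauchy_cvg; apply: cauchy_exP => e e0.
  have ee : e = (complex.Re e)%:C by rewrite RRe_real// ger0_real// ltW.
  have [|N uN] := uC (complex.Re e); first by rewrite -ltcR -ee.
  exists (u N); exists N => // n /= Nn.
  by rewrite -ball_normE/= normE ee ltcR uN.
exists l => e e0; have : nbhs l (ball l e%:C).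
  by apply: nbhsx_ballx; rewrite ltcE/= eqxx.
move=> /ul[N _ uN]; exists N => n /uN/=.
by rewrite -ball_normE/= normE ltcR rnormB.
Qed.

Lemma subspaceB L u v : linear_subspace L -> L u -> L v -> L (u - v).
Proof. by move=> [_ Ll] Lu Lv; rewrite addrC -scaleN1r; exact: Ll. Qed.

Lemma subspaceD L u v : linear_subspace L -> L u -> L v -> L (u + v).
Proof. by move=> [_ Ll] Lu Lv; rewrite -[u]scale1r; exact: Ll. Qed.

Lemma subspaceZ L a u : linear_subspace L -> L u -> L (a *: u).
Proof. by move=> [L0 Ll] Lu; rewrite -[_ *: _]addr0; exact: Ll. Qed.

Theorem projection L f : linear_subspace L -> closed L ->
  exists2 p, L p & forall w, L w -> ip (f - p) w = 0.
Proof.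
move=> subL cL; pose A := [set rnorm (f - v) ^+ 2 | v in L].
have infA : has_inf A.
  split; first by exists (rnorm (f - 0) ^+ 2), 0 => //; case: subL.
  by exists 0 => _ [v _ <-]; exact: sqr_ge0.
pose d := inf A.
have dle v : L v -> d <= rnorm (f - v) ^+ 2.
  by move=> Lv; apply: ge_inf; [exact: infA.2|exists v].
have /choice[v vP] (n : nat) : exists v, L v /\ rnorm (f - v) ^+ 2 < d + n.+1%:R^-1.
  have n0 : 0 < n.+1%:R^-1 :> R by rewrite invr_gt0.
  by have [_ [v Lv <-] vd] := inf_adherent n0 infA; exists v.
(* The midpoint of [v m] and [v n] lies in L, so its squared distance to f is at least d. The
   parallelogram law turns this into a Cauchy estimate. *)
have vv m n : rnorm (v m - v n) ^+ 2 <= 2 * (m.+1%:R^-1 + n.+1%:R^-1).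
  have [Lm ltm] := vP m; have [Ln ltn] := vP n.
  have := dle (2^-1%:C *: (v m + v n)).
  have -> : f - 2^-1%:C *: (v m + v n) = 2^-1%:C *: ((f - v m) + (f - v n)).
    have {1}-> : f = 2^-1%:C *: (f + f).
      rewrite -[in RHS](scale1r f) -scalerDl scalerA.
      by rewrite -(rmorph1 (real_complex R)) -rmorphD -rmorphM mulVf ?scale1r// pnatr_eq0.
    by rewrite -scalerBr addrACA -opprD.
  rewrite rnormZR => /(_ (subspaceZ _ subL (subspaceD subL Lm Ln))).
  rewrite ger0_norm// exprMn => dh.
  have -> : v m - v n = (f - v n) - (f - v m).
    by rewrite [RHS]addrC opprB addrA subrK.
  have := parallelogram ip_norm (f - v n) (f - v m).
  rewrite [f - v n + _]addrC.
  set x := rnorm (f - v n - (f - v m)) ^+ 2; set y := rnorm (f - v m + _) ^+ 2.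
  move: dh; rewrite -/y; move: ltm ltn; move: (m.+1%:R^-1) (n.+1%:R^-1).
  have -> : 2^-1 ^+ 2 * y = y / 4 by field.
  by move=> i j; lra.
have [|p vp] := @rnorm_complete v.
  move=> e e0; have [N Ne] := @invS_lt (e ^+ 2 / 4) ltac:(by rewrite divr_gt0// exprn_gt0).
  exists N => m n Nm Nn.
  rewrite -ltr_sqr ?nnegrE ?rnorm_ge0 ?ltW//.
  have := vv m n; have := Ne _ Nm; have := Ne _ Nn.
  by move: (m.+1%:R^-1) (n.+1%:R^-1) => i j; lra.
have Lp : L p.
  apply: closed_rnorm cL _ => e e0; have [N vN] := vp e e0.
  by exists (v N); [exact: (vP N).1|rewrite rnormB vN].
exists p => // w Lw; apply: ip_orth => a.
have {Lw} : L (a *: w) by exact: subspaceZ.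
move: {w} (a *: w) => w Lw.
set x := rip _ _; set W := rnorm w ^+ 2.
have W0 : 0 <= W by exact: sqr_ge0.
(* Minimality of the distance along p + t w. It is derived from the approximants [v n], each within
   1/(n+1) of the infimum; c makes the error of replacing p by [v n] at most e / 2. *)
have xt (t : R) : 2 * t * x <= t ^+ 2 * W.
  apply/ler_addgt0Pr => e e0.
  pose c : R := (2 * `|t| * rnorm w + 1) * 2.
  have c0 : 0 < c by rewrite mulr_gt0// ltr_pwDr// mulr_ge0// ?rnorm_ge0// mulr_ge0.
  have [N1 N1P] := invS_lt (divr_gt0 e0 (ltr0n R 2)).
  have [N2 N2P] := vp (e / c) (divr_gt0 e0 c0).
  pose n := maxn N1 N2.
  have h1 := N1P n (leq_maxl _ _); have h2 := N2P n (leq_maxr _ _).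
  have [Ln ltn] := vP n.
  have := dle _ (subspaceD subL Ln (subspaceZ t%:C subL Lw)).
  rewrite opprD addrA (rnormB2 ip_norm) ripZr rnormZR exprMn real_normK ?num_real//.
  rewrite -/W => dh.
  have -> : x = rip (f - v n) w + rip (v n - p) w.
    by rewrite -ripDl /x addrA subrK.
  have : `|2 * t * rip (v n - p) w| <= e / 2.
    rewrite !normrM (ger0_norm (ler0n _ 2)).
    move: h2; rewrite ltr_pdivlMr// /c => h2.
    have := normr_rip_le ip_norm (v n - p) w.
    have := rnorm_ge0 (v n - p); have := rnorm_ge0 w; have := normr_ge0 t.
    move: h2; move: (rnorm (v n - p)) (rnorm w) (`|t|) (`|rip (v n - p) w|).
    move=> Z Y T X h2 T0 Y0 Z0 XZY.
    by have := ler_wpM2l T0 XZY; lra.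
  rewrite ler_norml => /andP[_ h3].
  rewrite mulrDr; move: dh h1 h3 ltn; move: (n.+1%:R^-1) => i; lra.
(* The optimal t would be x / W; adding 1 covers W = 0 and still gives 2 x^2 (W + 1) <= x^2 W, hence
   x = 0. *)
have := xt (x / (W + 1)).
have W1 : 0 < W + 1 by rewrite ltr_wpDl.
rewrite -(ler_pM2r (exprn_gt0 2 W1)).
have -> : 2 * (x / (W + 1)) * x * (W + 1) ^+ 2 = 2 * x ^+ 2 * (W + 1).
  by field; rewrite lt0r_neq0.
have -> : (x / (W + 1)) ^+ 2 * W * (W + 1) ^+ 2 = x ^+ 2 * W.
  by field; rewrite lt0r_neq0.
move=> h; apply/eqP; rewrite -sqrf_eq0 eq_le sqr_ge0 andbT.
have : 0 <= x ^+ 2 * W by rewrite mulr_ge0// sqr_ge0.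
by have := sqr_ge0 x; lra.
Qed.

Lemma orthogonal_setT L : linear_subspace L -> closed L ->
  (forall f, (forall w, L w -> ip f w = 0) -> f = 0) -> forall f, L f.
Proof.
move=> subL cL L0 f; have [p Lp fp] := projection f subL cL.
by rewrite -(subrK p f) (L0 _ fp) add0r.
Qed.

End Completeness.

(** * The uniform boundedness principle *)

Section UniformBoundedness.
Context {R : realType} {H : completeNormedModType R[i]}.
Variables (ip : {dot H for Num.conj}).
Hypothesis ip_norm : forall u : H, `|u| ^+ 2 = ip u u.
Local Notation rip := (rip ip).

(* Gliding hump with steps of length 3^-n: the sum of the later steps is half
   of the current one. *)
Theorem uniform_boundedness (X : set H) :
  (forall f, exists M : R, forall x, X x -> `|rip f x| <= M) ->
  exists M : R, forall x, X x -> rnorm x <= M.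
Proof.
move=> ptX; apply: contrapT => /forallNP unb.
pose q n : R := 3^-1 ^+ n.
have q0 n : 0 < q n by rewrite exprn_gt0.
have qS n : q n.+1 = q n / 3 by rewrite /q exprSr.
have /choice[x xP] (n : nat) : exists x, X x /\ n.+1%:R / q n < rnorm x.
  have /existsNP[x /not_implyP[Xx /negP]] := unb (n.+1%:R / q n).
  by rewrite -ltNge => ?; exists x.
have x0 n : 0 < rnorm (x n).
  by apply: le_lt_trans (xP n).2; rewrite divr_ge0// ltW.
(* The sign of the step is that of the pairing already present, so the step cannot cancel it and the
   hump has at least its full size. *)
pose st f n := let t := q n / rnorm (x n) in
  f + ((if 0 <= rip f (x n) then t else - t)%:C *: x n).
pose F := fix F n := if n is m.+1 then st (F m) m else 0.
have stn n : rnorm (F n.+1 - F n) = q n.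
  rewrite /= /st addrAC subrr add0r rnormZR.
  by case: ifP => _; rewrite ?normrN ger0_norm ?divfK ?gt_eqF// divr_ge0 ?ltW.
have hump n : q n * rnorm (x n) <= `|rip (F n.+1) (x n)|.
  rewrite /= /st ripDl ripZl rip_self//.
  have h : q n / rnorm (x n) * rnorm (x n) ^+ 2 = q n * rnorm (x n).
    by field; exact/lt0r_neq0/x0.
  case: ifPn => [r0|]; first by rewrite h ger0_norm ?ler_wpDl ?addr_ge0// mulr_ge0 ?ltW.
  rewrite -ltNge mulNr h => r0; rewrite -normrN opprD opprK ger0_norm.
    by rewrite lerDr oppr_ge0 ltW.
  by rewrite addr_ge0 ?oppr_ge0 ?mulr_ge0// ltW.
have tail n k : rnorm (F (n + k)%N - F n) <= 3 / 2 * (q n - q (n + k)%N).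
  elim: k => [|k IH]; first by rewrite addn0 !subrr rnorm0 mulr0.
  rewrite addnS -(subrK (F (n + k)%N) (F _.+1)) -addrA.
  apply: le_trans (rnorm_triangle _ _) _; rewrite stn qS.
  by move: IH; lra.
have tail' n m : (n <= m)%N -> rnorm (F m - F n) <= 3 / 2 * q n.
  move=> nm; have := tail n (m - n)%N; rewrite subnKC// => /le_trans; apply.
  by have := q0 m; lra.
have qlt (e : R) : 0 < e -> exists n, q n < e.
  move=> e0; have [N Ne] := invS_lt e0; exists N; apply: le_lt_trans (Ne _ (leqnn _)).
  rewrite /q exprVn lef_pV2 ?posrE ?exprn_gt0// -natrX ler_nat.
  exact: ltn_expl.
have [|f fP] := @rnorm_complete _ _ F.
  move=> e e0; have [N qN] := qlt (e / 3) (divr_gt0 e0 (ltr0n R 3)).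
  exists N => m n Nm Nn; rewrite -(subrK (F N) (F m)) -addrA.
  apply: le_lt_trans (rnorm_triangle _ _) _; rewrite (rnormB (F N)).
  by have := tail' _ _ Nm; have := tail' _ _ Nn; lra.
have flim n : rnorm (f - F n.+1) <= q n / 2.
  apply/ler_addgt0Pr => e e0; have [N FN] := fP e e0.
  have := FN _ (leq_maxl N n.+1); have := tail' _ _ (leq_maxr N n.+1).
  rewrite qS; set m := maxn _ _ => h1 h2; rewrite -(subrK (F m) f) -addrA.
  by apply: le_trans (rnorm_triangle _ _) _; rewrite (rnormB f); lra.
have [M fM] := ptX f.
(* The hump at n exceeds n + 1 by the choice of [x n], and the later steps remove at most half of
   it. *)
have [n Mn] : exists n : nat, M < n.+1%:R / 2.
  exists (Num.truncn (2 * M)); rewrite ltr_pdivlMr// mulrC; exact: Num.Theory.truncnS_gt.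
have [Xx xn] := xP n; have := fM _ Xx; apply/negP; rewrite -ltNge.
apply: lt_le_trans Mn _; have := hump n.
rewrite -[F n.+1](subrK f) ripDl => h.
have := le_trans h (ler_normD _ _) => {}h.
have := normr_rip_le ip_norm (F n.+1 - f) (x n); rewrite rnormB => h1.
have := ler_wpM2r (rnorm_ge0 (x n)) (flim n).
move: xn; rewrite ltr_pdivrMr//.
by move: h h1; lra.
Qed.

End UniformBoundedness.

(** * Selfadjoint operators and resolvents *)

Lemma subrACA (V : zmodType) (a b c d : V) : a - b - (c - d) = a - c - (b - d).
Proof. by rewrite !opprB [LHS]addrACA [RHS]addrACA [- b - c]addrC. Qed.

Section ClosureProd.
Context {R : realType} {U V : normedModType R[i]}.

Lemma closure_prodP (X : set (U * V)) (p : U * V) :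
  closure X p <-> forall e : R, 0 < e -> exists q, [/\ X q, rnorm (p.1 - q.1) < e &
    rnorm (p.2 - q.2) < e].
Proof.
split=> [Xp e e0|Xp B [[B1 B2] /= [/nbhs_ballP[e1 /= e10 eB1] /nbhs_ballP[e2 /= e20 eB2]] B12]].
  have e0' : 0 < e%:C by rewrite ltcE/= eqxx.
  have [|q [Xq [/=]]] := Xp (ball p.1 e%:C `*` ball p.2 e%:C).
    by exists (ball p.1 e%:C, ball p.2 e%:C) => //; split; exact: nbhsx_ballx.
  by rewrite -!ball_normE/= !normE !ltcR; exists q.
have [r1 E1] := gt0_complex e10; have [r2 E2] := gt0_complex e20.
have [|q [Xq]] := Xp (Num.min (complex.Re e1) (complex.Re e2)); first by rewrite lt_min r1.
rewrite !lt_min => /andP[q1 _] /andP[_ q2]; exists q; split => //.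
apply: B12; split => /=.
  by apply: eB1; rewrite -ball_normE/= normE -E1 ltcR.
by apply: eB2; rewrite -ball_normE/= normE -E2 ltcR.
Qed.

End ClosureProd.

Section LinopTheory.
Context {K : nzRingType} {U V : lmodType K} (A : linop U V).
Implicit Types (u v : U).

Lemma op_dom0 : op_dom A 0. Proof. by case: (dom_subspace A). Qed.

Lemma op_domP (a : K) u v : op_dom A u -> op_dom A v -> op_dom A (a *: u + v).
Proof. by case: (dom_subspace A) => _; exact. Qed.

Lemma op_domZ (a : K) u : op_dom A u -> op_dom A (a *: u).
Proof. by move=> Au; rewrite -[_ *: _]addr0; apply: op_domP => //; exact: op_dom0. Qed.

Lemma op_domD u v : op_dom A u -> op_dom A v -> op_dom A (u + v).
Proof. by move=> Au Av; rewrite -[u]scale1r; exact: op_domP. Qed.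

Lemma op_domB u v : op_dom A u -> op_dom A v -> op_dom A (u - v).
Proof. by move=> Au Av; rewrite addrC -scaleN1r; exact: op_domP. Qed.

Lemma op0 : A 0 = 0.
Proof.
have := opfun_linear (-1) op_dom0 op_dom0.
by rewrite scaler0 addr0 scaleN1r addNr.
Qed.

Lemma opZ (a : K) u : op_dom A u -> A (a *: u) = a *: A u.
Proof.
move=> Au; rewrite -[a *: u]addr0 opfun_linear//; last exact: op_dom0.
by rewrite op0 addr0.
Qed.

Lemma opD u v : op_dom A u -> op_dom A v -> A (u + v) = A u + A v.
Proof. by move=> Au Av; rewrite -[u]scale1r opfun_linear// !scale1r. Qed.

Lemma opB u v : op_dom A u -> op_dom A v -> A (u - v) = A u - A v.
Proof. by move=> Au Av; rewrite addrC -scaleN1r opfun_linear// scaleN1r addrC. Qed.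

End LinopTheory.

Section Operators.
Context {R : realType} {H : completeNormedModType R[i]}.
Variables (ip : {dot H for Num.conj}).
Hypothesis ip_norm : forall u : H, `|u| ^+ 2 = ip u u.
Implicit Types (u v w f : H) (z : R[i]) (A : linop H H).
Local Notation rip := (rip ip).

(** A metric form of closedness, available both for an operator with topologically closed graph and
    for a selfadjoint operator, whose graph is an adjoint. *)
Definition graph_closed A := forall u f, (forall e : R, 0 < e ->
    exists v, [/\ op_dom A v, rnorm (u - v) < e & rnorm (f - A v) < e]) ->
  op_dom A u /\ A u = f.

Lemma closed_graph_closed A : closed (op_graph A) -> graph_closed A.
Proof.
move=> cA u f uf; apply: (cA (u, f)); apply/closure_prodP => e /uf[v [Av uv fv]].
by exists (v, A v).
Qed.

Definition bounded_below A z (c : R) :=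
  forall u, op_dom A u -> c * rnorm u <= rnorm (A u - z *: u).

(** The lower bound makes preimages of a convergent sequence Cauchy, and the closed graph identifies
    the image of their limit. *)
Lemma closed_range A z c : graph_closed A -> 0 < c -> bounded_below A z c ->
  closed (op_ran (op_shift A z)).
Proof.
move=> cA c0 Az f /closure_rnormP fr.
have /choice[u uP] (n : nat) :
    exists u, op_dom A u /\ rnorm (f - (A u - z *: u)) < n.+1%:R^-1.
  have [_ [u Au <-] fu] := fr _ (ltac:(by rewrite invr_gt0) : 0 < n.+1%:R^-1 :> R).
  by exists u.
have [|l ul] := @rnorm_complete _ _ u.
  move=> e e0; have [N Ne] := invS_lt (mulr_gt0 c0 (divr_gt0 e0 (ltr0n R 2))).
  exists N => m n /Ne hm /Ne hn.
  have [Am ltm] := uP m; have [An ltn] := uP n.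
  rewrite -(ltr_pM2l c0); apply: le_lt_trans (Az _ (op_domB Am An)) _.
  have -> : A (u m - u n) - z *: (u m - u n) =
      (f - (A (u n) - z *: u n)) + - (f - (A (u m) - z *: u m)).
    by rewrite opB// scalerBr subrACA [RHS]addrC [in RHS]opprB [RHS]addrA [in RHS]subrK.
  apply: le_lt_trans (rnorm_triangle _ _) _; rewrite rnormN.
  by move: hm hn ltm ltn; move: (m.+1%:R^-1) (n.+1%:R^-1) => i j; lra.
have [Al Alf] : op_dom A l /\ A l = f + z *: l.
  apply: cA => e e0; pose d := e / (cabs z + 2).
  have z0 := cabs_ge0 z; have z20 : 0 < cabs z + 2 by rewrite ltr_wpDl.
  have d0 : 0 < d by rewrite divr_gt0.
  have de : d * (cabs z + 2) = e by rewrite /d divfK// gt_eqF.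
  have [N1 h1] := invS_lt d0; have [N2 h2] := ul d d0.
  pose n := maxn N1 N2; have {}h1 := h1 n (leq_maxl _ _).
  have {}h2 := h2 n (leq_maxr _ _); have [An fn] := uP n.
  exists (u n); split => //.
    by rewrite rnormB; apply: lt_trans h2 _; nra.
  have -> : f + z *: l - A (u n) = (f - (A (u n) - z *: u n)) + z *: (l - u n).
    by rewrite scalerBr opprB [RHS]addrACA [z *: _ - _ - _]addrAC subrr add0r.
  apply: le_lt_trans (rnorm_triangle _ _) _; rewrite rnormZ.
  have := ler_wpM2l z0 (ltW h2); rewrite (rnormB (u n)).
  by move: fn h1; move: (n.+1%:R^-1) => i; rewrite -de; lra.
by exists l => //=; rewrite Alf addrK.
Qed.

Lemma range_subspace A : linear_subspace (op_ran A).
Proof.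
split; first by exists 0; [exact: op_dom0|exact: op0].
move=> a _ _ [u Au <-] [v Av <-]; exists (a *: u + v); first exact: op_domP.
exact: opfun_linear.
Qed.

(** With z = x + i y, the number ((A - x) u, u) is real by symmetry, so the cross term of (A - x) u
    with i y u has no real part. *)
Lemma shift_norm2 A z u : ip (A u) u = ip u (A u) ->
  rnorm (A u - z *: u) ^+ 2 =
  rnorm (A u - (complex.Re z)%:C *: u) ^+ 2 + complex.Im z ^+ 2 * rnorm u ^+ 2.
Proof.
move=> Au; set x := complex.Re z; set y := complex.Im z.
have -> : A u - z *: u = (A u - x%:C *: u) - (0 +i* y)%C *: u.
  rewrite -addrA -opprD -scalerDl; congr (_ - _ *: _).
  by case: z @x @y => a b /=; apply/eqP; rewrite eq_complex/= addr0 add0r !eqxx.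
rewrite (rnormB2 ip_norm) rnormZ exprMn cabs2/= expr0n add0r.
suff -> : rip (A u - x%:C *: u) ((0 +i* y)%C *: u) = 0 by rewrite mulr0 subr0.
rewrite /rip ipZr ipBl ipZl ip_self// conjCE/=.
have : complex.Im (ip (A u) u) = 0.
  have := Au; rewrite [ip u _]ipC conjCE; case: (ip _ _) => p q /= [].
  by move=> /eqP; rewrite -subr_eq0 opprK -mulr2n mulrn_eq0/= => /eqP.
by case: (ip _ _) => p q /= ->; rewrite !(mul0r, mulr0, addr0, add0r, subr0, oppr0, mulrN).
Qed.

Lemma nonreal_bounded_below A z : (forall u, op_dom A u -> ip (A u) u = ip u (A u)) ->
  bounded_below A z `|complex.Im z|.
Proof.
move=> sA u Au; rewrite -ler_sqr ?nnegrE ?mulr_ge0 ?rnorm_ge0//.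
by rewrite exprMn real_normK ?num_real// (shift_norm2 _ (sA _ Au)) lerDr sqr_ge0.
Qed.

Section SelfAdjoint.
Variable A : linop H H.
Hypothesis sA : selfadjoint ip A.

Lemma sa_symm u v : op_dom A u -> op_dom A v -> ip (A u) v = ip u (A v).
Proof.
move=> Au Av; have : op_graph A (v, A v) by [].
by case: sA => _ <-; apply.
Qed.

Lemma sa_adj u f : (forall v, op_dom A v -> ip (A v) u = ip v f) ->
  op_dom A u /\ A u = f.
Proof. by move=> h; have : adjoint ip A (u, f) by []; case: sA => _ ->. Qed.

Lemma sa_graph_closed : graph_closed A.
Proof.
move=> u f uf; apply: sa_adj => v Av.
suff re0 w : op_dom A w -> rip (A w) u = rip w f.
  have := re0 _ (op_domZ 'i%C Av); rewrite opZ// /rip !ipZl.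
  move: (re0 _ Av); rewrite /rip; case: (ip _ _) => a b; case: (ip _ _) => c d /= ->.
  by rewrite !mul0r !mul1r !sub0r => /oppr_inj ->.
move=> {v Av} Aw; apply/eqP; rewrite -subr_eq0 -normr_le0.
apply/ler_addgt0Pr => e e0; rewrite add0r.
pose c : R := rnorm (A w) + rnorm w + 1.
have c0 : 0 < c by rewrite ltr_wpDl// addr_ge0// rnorm_ge0.
have [v [Av]] := uf (e / c) (divr_gt0 e0 c0).
rewrite !ltr_pdivlMr// /c => uv fv.
have -> : rip (A w) u - rip w f = rip (A w) (u - v) - rip w (f - A v).
  have wv : rip (A w) v = rip w (A v) by rewrite /rip sa_symm.
  by rewrite !ripBr wv; ring.
have := normr_rip_le ip_norm (A w) (u - v); have := normr_rip_le ip_norm w (f - A v).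
have := rnorm_ge0 (u - v); have := rnorm_ge0 (f - A v).
have := rnorm_ge0 w; have := rnorm_ge0 (A w).
move=> h1 h2 h3 h4 h5 h6; apply: le_trans (ler_normB _ _) _.
have : rnorm (A w) * rnorm (u - v) + rnorm w * rnorm (f - A v) <= e by nra.
by lra.
Qed.

Lemma sa_bounded_below_conj z c : bounded_below A z c -> bounded_below A (Num.conj z) c.
Proof.
move=> Az u Au; apply: le_trans (Az _ Au) _.
rewrite -ler_sqr ?nnegrE ?rnorm_ge0//.
have Auu := sa_symm Au Au.
by rewrite (shift_norm2 z Auu) (shift_norm2 (Num.conj z) Auu) conjCE/= sqrrN.
Qed.

Lemma bounded_below_inj (B : linop H H) z c u v : 0 < c -> bounded_below B z c ->
  op_dom B u -> op_dom B v -> B u - z *: u = B v - z *: v -> u = v.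
Proof.
move=> c0 Bz Bu Bv uv; apply/eqP; rewrite -subr_eq0; apply/eqP/rnorm0_eq0.
have := Bz _ (op_domB Bu Bv).
have -> : B (u - v) - z *: (u - v) = 0.
  by rewrite opB// scalerBr subrACA uv subrr.
rewrite rnorm0 pmulr_rle0// => h; apply/eqP.
by rewrite eq_le h rnorm_ge0.
Qed.

(** A lower bound gives injectivity and a closed range. A vector orthogonal to the range is an
    eigenvector at conj z, where the same lower bound holds, so it vanishes. *)
Lemma resolventP z : resolvent_set A z <-> exists2 c, 0 < c & bounded_below A z c.
Proof.
split=> [[_ [[a b] Ac]]|[c c0 Az]].
  (* The constant in [resolvent_set] is complex and only its real part [a] matters. It need not be
     positive when the space is trivial, hence the added 1. *)
  pose d := `|a| + 1; have d0 : 0 < d by rewrite ltr_pwDr.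
  exists d^-1; first by rewrite invr_gt0.
  move=> u /Ac; rewrite !normE lecE/= => /andP[_ h].
  rewrite mulrC ler_pdivrMr// (le_trans h)// mulr0 subr0 mulrC ler_wpM2l ?rnorm_ge0//.
  by rewrite /d ler_wpDr// ler_norm.
split; last first.
  exists (c^-1)%:C => u Au; rewrite !normE -rmorphM lecR mulrC ler_pdivlMr// mulrC.
  exact: Az.
split; [by []|move=> u v; rewrite !inE => Au Av; exact: (bounded_below_inj c0 Az)|move=> f _].
  rewrite -[_ @` _]/(op_ran (op_shift A z)).
  apply: (orthogonal_setT ip_norm) => [||{}f fA]; first exact: range_subspace.
    exact: closed_range sa_graph_closed c0 Az.
  have [Af Afz] : op_dom A f /\ A f = Num.conj z *: f.
    apply: sa_adj => v Av; rewrite ipZr conjCK -ipZl; apply/eqP; rewrite -subr_eq0 -ipBl.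
    by apply/eqP/(ip_eq0C (fA _ _)); exists v.
  have := sa_bounded_below_conj Az Af; rewrite Afz subrr rnorm0 pmulr_rle0// => f0.
  by apply: rnorm0_eq0; apply/eqP; rewrite eq_le f0 rnorm_ge0.
Qed.

Lemma nonreal_resolvent z : complex.Im z != 0 -> resolvent_set A z.
Proof.
move=> z0; apply/resolventP; exists `|complex.Im z|; first by rewrite normr_gt0.
by apply: nonreal_bounded_below => u Au; rewrite sa_symm.
Qed.

Lemma resolvent_conj z : resolvent_set A z -> resolvent_set A (Num.conj z).
Proof.
by move=> /resolventP[c c0 h]; apply/resolventP; exists c => //; exact: sa_bounded_below_conj.
Qed.

Lemma bounded_below_near (B : linop H H) z (w : R[i]) c : bounded_below B z c ->
  bounded_below B w (c - cabs (w - z)).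
Proof.
move=> Az u Au; rewrite mulrBl lerBlDr -rnormZ (le_trans (Az _ Au))//.
apply: le_trans (rnorm_triangle _ _).
by rewrite scalerBl addrA subrK.
Qed.

(** A total choice of preimage, with value 0 where none exists. On the resolvent set the preimage is
    unique and this is the resolvent. *)
Definition resolv z f : H := xget 0 [set u | op_dom A u /\ A u - z *: u = f].

Lemma resolv_spec z f : resolvent_set A z ->
  op_dom A (resolv z f) /\ A (resolv z f) - z *: resolv z f = f.
Proof.
move=> [[_ _ sur] _]; have [u Au uf] : op_ran (op_shift A z) f by exact: sur.
by apply: (@xgetPex _ 0 [set u | op_dom A u /\ A u - z *: u = f]); exists u.
Qed.

Lemma resolv_unique z f u : resolvent_set A z -> op_dom A u -> A u - z *: u = f ->
  u = resolv z f.
Proof.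
move=> rz Au uf; have [Ar rf] := resolv_spec f rz.
by have /resolventP[c c0 h] := rz; apply: (bounded_below_inj c0 h) => //; rewrite uf rf.
Qed.

Lemma resolvB z f f' : resolvent_set A z ->
  resolv z (f - f') = resolv z f - resolv z f'.
Proof.
move=> rz; have [a1 a2] := resolv_spec f rz; have [b1 b2] := resolv_spec f' rz.
apply/esym/(resolv_unique rz); first exact: op_domB.
by rewrite opB// scalerBr subrACA a2 b2.
Qed.

End SelfAdjoint.
End Operators.

(** * The spectral measure *)

Section SpectralProjections.
Context {R : realType} {H : completeNormedModType R[i]}.
Variables (ip : {dot H for Num.conj}).
Hypothesis ip_norm : forall u : H, `|u| ^+ 2 = ip u u.
Variables (A : linop H H) (E : set R -> {linear H -> H}).
Hypothesis hE : spectral_measure ip A E.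
Implicit Types (u v w : H) (B C : set (measurableTypeR R)).
Local Notation rip := (rip ip).

Lemma E_idem B u : measurable B -> E B (E B u) = E B u.
Proof. by move=> mB; rewrite (spectral_idempotent hE). Qed.

Lemma E_sym B u v : measurable B -> ip (E B u) v = ip u (E B v).
Proof. by move=> mB; rewrite (spectral_symmetric hE). Qed.

Lemma E_setT u : E setT u = u.
Proof. exact: (spectral_setT hE). Qed.

Lemma rip_E B u : measurable B -> rip (E B u) u = rnorm (E B u) ^+ 2.
Proof. by move=> mB; rewrite -(rip_self ip_norm) /rip -[in RHS]E_sym// E_idem. Qed.

Lemma E_sigma (F : (set (measurableTypeR R))^nat) u (e : R) :
  (forall n, measurable (F n)) -> trivIset setT F -> 0 < e ->
  exists N, forall n, (N <= n)%N ->
    rnorm (E (\bigcup_n F n) u - \sum_(0 <= i < n) E (F i) u) < e.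
Proof.
move=> mF tF e0; have := @spectral_sigma_additive _ _ _ _ _ hE F mF tF u.
have : nbhs (E (\bigcup_n F n) u) (ball (E (\bigcup_n F n) u) e%:C).
  by apply: nbhsx_ballx; rewrite ltcE/= eqxx.
move=> + h => /h[N _ NP]; exists N => n /NP /=.
by rewrite -ball_normE/= normE ltcR.
Qed.

(** For the constant sequence of empty sets, consecutive partial sums differ by [E set0 u] while
    both approach the same limit. *)
Lemma E_set0 u : E set0 u = 0.
Proof.
apply: rnorm_small => e e0.
have [|||N NP] := @E_sigma (fun=> set0) u (e / 2); rewrite ?divr_gt0//.
  exact: trivIset_set0.
have := NP _ (leqnn N); have := NP _ (leqnSn N); rewrite big_nat_recr//=.
set s := \sum_(0 <= i < N) _; set t := E (\bigcup_n _) u; set x := E set0 u.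
move=> h1 h2; have -> : x = (t - s) + - (t - (s + x)).
  by rewrite opprB addrC addrA subrK addrAC subrr add0r.
by apply: le_trans (rnorm_triangle _ _) _; rewrite rnormN; lra.
Qed.

Lemma E_setU B C u : measurable B -> measurable C -> B `&` C = set0 ->
  E (B `|` C) u = E B u + E C u.
Proof.
move=> mB mC BC; apply: subr0_eq; apply: rnorm_small => e e0.
have [||N] := @E_sigma (bigcup2 B C) u e _ _ e0.
- by move=> [|[|n]] //=; exact: measurable0.
- by rewrite -trivIset_bigcup2.
rewrite bigcup2E => /(_ _ (leq_addr 2 N)); rewrite addn2 !big_nat_recl//=.
by rewrite big1 ?addr0 => [/ltW//|i _]; rewrite E_set0.
Qed.

Lemma E_setC B u : measurable B -> E (~` B) u = u - E B u.
Proof.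
move=> mB; apply/esym/(canLR (addrK _)).
by rewrite addrC -E_setU ?setICr// ?setUv ?E_setT//; exact: measurableC.
Qed.

Lemma E_orth B u v : measurable B -> ip (E B u) (E (~` B) v) = 0.
Proof. by move=> mB; rewrite E_setC// ipBr -[X in _ - X]E_sym// E_idem// subrr. Qed.

Lemma E_norm2 B u : measurable B ->
  rnorm u ^+ 2 = rnorm (E B u) ^+ 2 + rnorm (E (~` B) u) ^+ 2.
Proof.
move=> mB; rewrite -(pythagoras ip_norm (E_orth u u mB)) E_setC//.
by rewrite addrC subrK.
Qed.

Lemma E_le B u : measurable B -> rnorm (E B u) <= rnorm u.
Proof.
move=> mB; rewrite -ler_sqr ?nnegrE ?rnorm_ge0// (E_norm2 u mB).
by rewrite lerDl sqr_ge0.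
Qed.

Lemma E_setI B C u : measurable B -> measurable C -> E B (E C u) = E (B `&` C) u.
Proof.
(* With b = E Y v, additivity gives E (X [|] Y) b = E X b + b, of squared norm 3 |E X b|^2 + |b|^2.
   A projection does not increase |b|, so E X b = 0. *)
have disj X Y v : measurable X -> measurable Y -> X `&` Y = set0 -> E X (E Y v) = 0.
  move=> mX mY XY; set b := E Y v; apply: rnorm0_eq0.
  have := E_le b (measurableU _ _ mX mY); rewrite E_setU// [E Y b]E_idem//.
  rewrite -ler_sqr ?nnegrE ?rnorm_ge0// (rnormD2 ip_norm) rip_E// => h.
  apply/eqP; rewrite -sqrf_eq0 eq_le sqr_ge0 andbT.
  by move: h; have := sqr_ge0 (rnorm (E X b)); lra.
move=> mB mC.
have mI := measurableI _ _ mB mC.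
have -> : E C u = E (B `&` C) u + E (C `\` B) u.
  rewrite -E_setU ?setDE//; [by rewrite (setIC B) setUIDK|exact: measurableD|].
  by apply/seteqP; split=> x // -[[Bx _] [_ /(_ Bx)]].
rewrite linearD/= (@disj B (C `\` B)) ?addr0//; [|exact: measurableD|exact: setDIK].
set w := E (B `&` C) u.
have {1}-> : B = (B `&` C) `|` (B `\` C) by rewrite setUIDK.
rewrite E_setU//; [|exact: measurableD|].
  rewrite (@disj (B `\` C) (B `&` C)) ?addr0 ?[LHS]E_idem//; first exact: measurableD.
  by apply/seteqP; split=> x // -[[_ nC] [_ /nC]].
by apply/seteqP; split=> x // -[[_ Cx] [_ /(_ Cx)]].
Qed.

(* The values of E outside the Borel sets are unconstrained, so the set function
   [scalar_measure] is a measure only after restriction to the Borel sets. *)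
Lemma E_measure u : exists mu : {measure set (measurableTypeR R) -> \bar R},
  forall B, measurable B -> mu B = (rnorm (E B u) ^+ 2)%:E.
Proof.
pose m B : \bar R := if `[< measurable B >] then (rnorm (E B u) ^+ 2)%:E else 0%E.
have mE B : measurable B -> m B = (rnorm (E B u) ^+ 2)%:E by rewrite /m; case: asboolP.
have m0 : m set0 = 0%E by rewrite mE// E_set0 rnorm0 expr0n.
have m_ge0 B : (0 <= m B)%E by rewrite /m; case: asboolP => // _; rewrite lee_fin sqr_ge0.
have m_sigma : semi_sigma_additive m.
  move=> F mF tF mUF; rewrite mE//.
  rewrite (_ : (fun n => _) = EFin \o (fun n => rip (\sum_(0 <= i < n) E (F i) u) u)).
    apply: cvg_EFin; first exact: nearW.
    rewrite -rip_E//; apply/cvgrPdist_lt => e e0.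
    have c0 : 0 < rnorm u + 1 by rewrite ltr_wpDl ?rnorm_ge0.
    have [N NP] := E_sigma u mF tF (divr_gt0 e0 c0).
    exists N => // n /= /NP; rewrite ltr_pdivlMr// => h.
    rewrite -ripBl (le_lt_trans (normr_rip_le ip_norm _ _))//.
    by apply: le_lt_trans h; rewrite ler_wpM2l ?rnorm_ge0// lerDl.
  apply/funext => n /=; elim: n => [|n IH]; first by rewrite !big_nil /rip ip0l.
  by rewrite !big_nat_recr//= ripDl IH mE// rip_E.
pose mu : {measure set _ -> \bar R} :=
  HB.pack m (isMeasure.Build _ _ _ m m0 m_ge0 m_sigma).
by exists mu => B mB; rewrite -mE.
Qed.

End SpectralProjections.

(** * Commutation of A with E and form bounds on spectral subspaces *)

Section SpectralCalculus.
Import HBNNSimple.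
Context {R : realType} {H : completeNormedModType R[i]}.
Variables (ip : {dot H for Num.conj}).
Hypothesis ip_norm : forall u : H, `|u| ^+ 2 = ip u u.
Variables (A : linop H H) (E : set R -> {linear H -> H}).
Hypothesis sA : selfadjoint ip A.
Hypothesis hE : spectral_measure ip A E.
Implicit Types (u v w : H) (B C : set (measurableTypeR R)).
Implicit Types mu : {measure set (measurableTypeR R) -> \bar R}.
Local Notation rip := (rip ip).

Definition smeasure u mu :=
  forall B, measurable B -> mu B = (rnorm (E B u) ^+ 2)%:E.

(** The integral is a supremum over simple functions with Borel level sets, so only the values on
    Borel sets enter. Integrals against [scalar_measure] thus become integrals against a genuine
    measure. *)
Lemma integral_smeasure u mu (f : measurableTypeR R -> \bar R) : smeasure u mu ->
  (\int[scalar_measure ip E u]_t f t = \int[mu]_t f t)%E.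
Proof.
move=> umu; rewrite /integral.
congr (ereal_sup _ - ereal_sup _)%E; apply: eq_imagel => h _; apply: eq_fsbigr => r _;
  rewrite umu ?/scalar_measure -?(rip_E ip_norm hE)//; exact: measurable_funPTI.
Qed.

Lemma smeasure_fin u mu B : smeasure u mu -> measurable B -> (mu B < +oo)%E.
Proof. by move=> umu mB; rewrite umu// ltry. Qed.

Lemma dom_smeasureP u mu : smeasure u mu ->
  op_dom A u <-> (\int[mu]_t (t ^+ 2)%:E < +oo)%E.
Proof. by move=> umu; rewrite (spectral_dom hE)/= (integral_smeasure _ umu). Qed.

Lemma rip_A u mu : smeasure u mu -> op_dom A u ->
  rip (A u) u = fine (\int[mu]_t t%:E)%E.
Proof.
by move=> umu Au; rewrite /rip (spectral_integral hE)// (integral_smeasure _ umu).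
Qed.

Lemma measurable_sqr (D : set (measurableTypeR R)) :
  measurable_fun D (fun t : measurableTypeR R => ((t : R) ^+ 2)%:E).
Proof. by apply/measurable_EFinP; exact: measurable_funX. Qed.

Lemma measurable_EFin_id (D : set (measurableTypeR R)) :
  measurable_fun D (fun t : measurableTypeR R => (t : R)%:E).
Proof. by apply/measurable_EFinP. Qed.

(** The domain controls the second moment; the first follows from |t| <= 1 + t^2, the measure being
    finite. *)
Lemma smeasure_integrable u mu : smeasure u mu -> op_dom A u ->
  mu.-integrable setT (fun t => (t : R)%:E).
Proof.
move=> umu Au; have mu1 := smeasure_fin umu measurableT.
apply/integrableP; split; first exact: measurable_EFin_id.
apply: (@le_lt_trans _ _ (\int[mu]_t (cst 1%:E t + ((t : R) ^+ 2)%:E))%E).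
  apply: ge0_le_integral => //.
  - by apply: measurableT_comp => //; exact: measurable_EFin_id.
  - by apply: emeasurable_funD => //; exact: measurable_sqr.
  - move=> t _; rewrite /= lee_fin.
    have := sqr_ge0 (`|t| - 1); have := sqr_ge0 t; rewrite -(real_normK (num_real t)).
    by nra.
rewrite ge0_integralD//; [|by move=> t _; rewrite lee_fin sqr_ge0|exact: measurable_sqr].
by rewrite integral_cst// mul1e lte_add_pinfty//; apply/(dom_smeasureP umu).
Qed.

Lemma E_comm B C u : measurable B -> measurable C -> E B (E C u) = E C (E B u).
Proof. by move=> mB mC; rewrite !(E_setI ip_norm hE)// setIC. Qed.

Lemma smeasure_split B u mu mu1 mu2 : measurable B -> smeasure u mu ->
  smeasure (E B u) mu1 -> smeasure (E (~` B) u) mu2 ->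
  forall C, measurable C -> mu C = measure_add mu1 mu2 C.
Proof.
move=> mB u0 u1 u2 C mC; have mBC := measurableC mB.
rewrite measure_addE u0// u1// u2// -EFinD (E_norm2 ip_norm hE (E C u) mB).
by rewrite (E_comm _ mB)// (E_comm _ mBC).
Qed.

Lemma dom_E B u : measurable B -> op_dom A u -> op_dom A (E B u).
Proof.
move=> mB Au; have [mu u0] := E_measure ip_norm hE u.
have [mu1 u1] := E_measure ip_norm hE (E B u).
have [mu2 u2] := E_measure ip_norm hE (E (~` B) u).
apply/(dom_smeasureP u1); have /(dom_smeasureP u0) := Au.
rewrite (eq_measure_integral (measure_add mu1 mu2)); last first.
  by move=> C mC _; exact: (smeasure_split mB u0 u1 u2 mC).
rewrite ge0_integral_measure_add//; last 2 first.
- by move=> t _; rewrite lee_fin sqr_ge0.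
- exact: measurable_sqr.
apply: le_lt_trans; rewrite leeDl// integral_ge0// => t _.
by rewrite lee_fin sqr_ge0.
Qed.

Lemma form_split B u : measurable B -> op_dom A u ->
  rip (A u) u = rip (A (E B u)) (E B u) + rip (A (E (~` B) u)) (E (~` B) u).
Proof.
move=> mB Au; have [mu u0] := E_measure ip_norm hE u.
have [mu1 u1] := E_measure ip_norm hE (E B u).
have [mu2 u2] := E_measure ip_norm hE (E (~` B) u).
have A1 := dom_E mB Au; have A2 := dom_E (measurableC mB) Au.
rewrite (rip_A u0)// (rip_A u1)// (rip_A u2)//.
rewrite (eq_measure_integral (measure_add mu1 mu2)); last first.
  by move=> C mC _; exact: (smeasure_split mB u0 u1 u2 mC).
have i1 := smeasure_integrable u1 A1; have i2 := smeasure_integrable u2 A2.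
rewrite integral_measure_add//.
by rewrite fineD//; [exact: integrable_fin_num i1|exact: integrable_fin_num i2].
Qed.

Lemma E_A_orth B u v : measurable B -> op_dom A u -> op_dom A v ->
  ip (A (E B u)) (E (~` B) v) = 0.
Proof.
move=> mB Au Av; apply: ip_orth => a.
rewrite (_ : a *: _ = E (~` B) (a *: v)); last by rewrite linearZ.
have {Av} : op_dom A (a *: v) by exact: op_domZ.
move: (a *: v) => {a}v Av; have mB' := measurableC mB.
pose x := E B u; pose y := E (~` B) v.
have Ax : op_dom A x by exact: dom_E.
have Ay : op_dom A y by exact: dom_E.
have := form_split mB (op_domD Ax Ay).
have -> : E B (x + y) = x.
  rewrite linearD/= /x /y (E_idem hE)//.
  by rewrite (E_setI ip_norm hE)// setICr (E_set0 hE) addr0.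
have -> : E (~` B) (x + y) = y.
  rewrite linearD/= /x /y [E (~` B) (E (~` B) v)](E_idem hE)//.
  by rewrite (E_setI ip_norm hE)// setICl (E_set0 hE) add0r.
rewrite opD// ripDl !ripDr.
have -> : rip (A y) x = rip (A x) y by rewrite ripC /rip (sa_symm sA).
by rewrite -/x -/y; lra.
Qed.

(** By [E_A_orth] and the density of the domain, A maps the range of E C into itself, for C = B and
    for its complement. An invariant pair of complementary ranges means commutation. *)
Lemma A_E B u : measurable B -> op_dom A u -> A (E B u) = E B (A u).
Proof.
move=> mB Au; have mB' := measurableC mB.
have key C v : measurable C -> op_dom A v -> E (~` C) (A (E C v)) = 0.
  move=> mC Av; apply: (ip_dense0 ip_norm sA.1) => w Aw.
  by rewrite (E_sym hE)//; [exact: E_A_orth|exact: measurableC].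
have := key B u mB Au; rewrite (E_setC hE)// => /subr0_eq ->.
have {2}-> : u = E B u + E (~` B) u by rewrite (E_setC hE)// addrC subrK.
rewrite opD ?linearD/=; [|exact: dom_E|exact: dom_E].
by have := key _ u mB' Au; rewrite setCK => ->; rewrite addr0.
Qed.

Lemma smeasure_null J v mu : measurable J -> E J v = v -> smeasure v mu -> mu (~` J) = 0%E.
Proof.
move=> mJ Jv vmu; rewrite vmu; last exact: measurableC.
by rewrite (E_setC hE)// Jv subrr rnorm0 expr0n.
Qed.

Lemma dom_E_bounded (J : set (measurableTypeR R)) (M : R) u : measurable J ->
  (forall t : R, J t -> `|t| <= M) ->
  op_dom A (E J u).
Proof.
move=> mJ JM; have [mu vmu] := E_measure ip_norm hE (E J u).
apply/(dom_smeasureP vmu); have JJ : E J (E J u) = E J u by exact: (E_idem hE).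
have mJ' := measurableC mJ.
rewrite (ge0_negligible_integral mJ' measurableT); last 3 first.
- exact: measurable_sqr.
- by move=> t _; rewrite lee_fin sqr_ge0.
- exact: smeasure_null JJ vmu.
rewrite setTD setCK; apply: (@le_lt_trans _ _ (\int[mu]_(t in J) cst (M ^+ 2)%:E t)%E).
  apply: ge0_le_integral => //.
  - by move=> t _; rewrite lee_fin sqr_ge0.
  - exact: measurable_sqr.
  - move=> t Jt; rewrite lee_fin -(real_normK (num_real t)) lerXn2r ?nnegrE//.
      exact: le_trans (JM _ Jt).
    exact: JM.
by rewrite integral_cst// vmu// -EFinM ltry.
Qed.

Lemma rip_A_restrict (J : set (measurableTypeR R)) v mu : measurable J -> E J v = v ->
  op_dom A v -> smeasure v mu ->
  mu.-integrable J (fun t => (t : R)%:E) /\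
  (rip (A v) v)%:E = (\int[mu]_(t in J) (t : R)%:E)%E.
Proof.
move=> mJ Jv Av vmu; have ii := smeasure_integrable vmu Av; have mJ' := measurableC mJ.
have iJ : mu.-integrable J (fun t => (t : R)%:E) by exact: integrableS ii.
split=> //.
rewrite (rip_A vmu)// (negligible_integral mJ' measurableT ii (smeasure_null mJ Jv vmu)).
by rewrite setTD setCK fineK//; exact: integrable_fin_num iJ.
Qed.

Lemma smeasure_cst (J : set (measurableTypeR R)) v mu (a : R) : measurable J -> E J v = v ->
  smeasure v mu ->
  mu.-integrable J (cst a%:E) /\ (a * rnorm v ^+ 2)%:E = (\int[mu]_(t in J) cst a%:E t)%E.
Proof.
move=> mJ Jv vmu; split; last by rewrite integral_cst// vmu// Jv EFinM.
apply/integrableP; split; first exact: measurable_cst.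
by rewrite (integral_cst mu mJ `|a|%:E) vmu// -EFinM ltry.
Qed.

Lemma form_ge (J : set (measurableTypeR R)) (a : R) v : measurable J -> E J v = v ->
  op_dom A v -> (forall t : R, J t -> a <= t) -> a * rnorm v ^+ 2 <= rip (A v) v.
Proof.
move=> mJ Jv Av aJ; have [mu vmu] := E_measure ip_norm hE v.
have [i1 e1] := rip_A_restrict mJ Jv Av vmu; have [i2 e2] := smeasure_cst a mJ Jv vmu.
rewrite -lee_fin e1 e2; apply: le_integral => // t /set_mem/aJ.
by rewrite lee_fin.
Qed.

Lemma form_le (J : set (measurableTypeR R)) (b : R) v : measurable J -> E J v = v ->
  op_dom A v -> (forall t : R, J t -> t <= b) -> rip (A v) v <= b * rnorm v ^+ 2.
Proof.
move=> mJ Jv Av bJ; have [mu vmu] := E_measure ip_norm hE v.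
have [i1 e1] := rip_A_restrict mJ Jv Av vmu; have [i2 e2] := smeasure_cst b mJ Jv vmu.
rewrite -lee_fin e1 e2; apply: le_integral => // t /set_mem/bJ.
by rewrite lee_fin.
Qed.

End SpectralCalculus.

(** * Localization: gaps, spectral windows and eigenvectors *)

Section SpectralLocalization.
Context {R : realType} {H : completeNormedModType R[i]}.
Variables (ip : {dot H for Num.conj}).
Hypothesis ip_norm : forall u : H, `|u| ^+ 2 = ip u u.
Variables (A : linop H H) (E : set R -> {linear H -> H}).
Hypothesis sA : selfadjoint ip A.
Hypothesis hE : spectral_measure ip A E.
Implicit Types (u v w f : H) (B C J : set (measurableTypeR R)) (s d eta : R).
Local Notation rip := (rip ip).

Lemma E_sub B C u : measurable B -> measurable C -> C `<=` B -> E B (E C u) = E C u.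
Proof. by move=> mB mC CB; rewrite (E_setI ip_norm hE)// setIidr. Qed.

Lemma E_sub0 B C u : measurable B -> measurable C -> C `<=` B -> E B u = 0 -> E C u = 0.
Proof.
move=> mB mC CB u0; rewrite -(E_sub u mB mC CB) (E_comm ip_norm hE)// u0.
exact: linear0.
Qed.

Lemma E_sub_norm B C u : measurable B -> measurable C -> C `<=` B ->
  rnorm (E C u) <= rnorm (E B u).
Proof.
move=> mB mC CB; rewrite -(E_sub u mB mC CB) (E_comm ip_norm hE)//.
exact: (E_le ip_norm hE).
Qed.

Lemma rip_lower w v (c : R) : c * rnorm v ^+ 2 <= rip w v -> c * rnorm v <= rnorm w.
Proof.
move=> h; have := le_trans h (rip_le ip_norm w v).
have := rnorm_ge0 v; rewrite le_eqVlt => /predU1P[<- _|v0].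
  by rewrite mulr0 rnorm_ge0.
by rewrite expr2 mulrA ler_pM2r.
Qed.

Lemma rip_shift u (s : R) : rip (A u - s%:C *: u) u = rip (A u) u - s * rnorm u ^+ 2.
Proof. by rewrite ripBl ripZl (rip_self ip_norm). Qed.

Lemma E_shift B u (z : R[i]) : measurable B -> op_dom A u ->
  A (E B u) - z *: E B u = E B (A u - z *: u).
Proof. by move=> mB Au; rewrite [RHS]linearB/= [E B (z *: u)]linearZ/= (A_E ip_norm sA hE). Qed.

(** Without mass in the gap, u splits into p above s + d and q below s - d. The form of A - s is at
    least d |p|^2 on p and at most - d |q|^2 on q; Cauchy-Schwarz turns both into norm bounds, which
    add up by Pythagoras. *)
Lemma gap_lower_bound s d u : 0 < d -> op_dom A u ->
  E `]s - d, s + d[%classic u = 0 -> d * rnorm u <= rnorm (A u - s%:C *: u).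
Proof.
move=> d0 Au; set J0 : set (measurableTypeR R) := `]_, _[%classic => u0.
have mJ0 : measurable J0 by exact: measurable_itv.
pose B : set (measurableTypeR R) := `[s + d, +oo[%classic.
have mB : measurable B by exact: measurable_itv.
have mB' := measurableC mB.
pose N : set (measurableTypeR R) := `]-oo, s - d]%classic.
have mN : measurable N by exact: measurable_itv.
pose p := E B u; pose q := E (~` B) u.
have Ap : op_dom A p by exact: (dom_E ip_norm hE).
have Aq : op_dom A q by exact: (dom_E ip_norm hE).
have Nq : E N q = q.
  have -> : q = E N u; last exact: (E_idem hE).
  rewrite /q (_ : ~` B = N `|` (J0 `\` N)).
    rewrite (E_setU hE)//; [|exact: measurableD|by rewrite setDIK].
    by rewrite (@E_sub0 J0 (J0 `\` N) u) ?addr0//; exact: measurableD.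
  apply/seteqP; split=> t; rewrite /B /N /J0 /= !in_itv/= ?andbT.
    move=> /negP; rewrite -ltNge => td.
    have [tn|tn] := leP t (s - d); first by left.
    by right; split; first exact/andP.
  case=> [tn|[/andP[_ td] _]]; apply/negP; rewrite -ltNge//.
  by apply: le_lt_trans tn _; lra.
have hp : d * rnorm p <= rnorm (A p - s%:C *: p).
  apply: rip_lower; rewrite rip_shift.
  have := @form_ge _ _ ip ip_norm _ _ hE B (s + d) p mB (E_idem hE u mB) Ap.
  have Bs (t : R) : B t -> s + d <= t by rewrite /B/= in_itv/= andbT.
  by move=> /(_ Bs); lra.
have hq : d * rnorm q <= rnorm (A q - s%:C *: q).
  rewrite -[leRHS]rnormN; apply: rip_lower; rewrite ripNl rip_shift.
  have := @form_le _ _ ip ip_norm _ _ hE N (s - d) q mN Nq Aq.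
  have Ns (t : R) : N t -> t <= s - d by rewrite /N/= in_itv.
  by move=> /(_ Ns); lra.
rewrite -ler_sqr ?nnegrE ?rnorm_ge0 ?mulr_ge0 ?rnorm_ge0 ?(ltW d0)//.
rewrite exprMn (E_norm2 ip_norm hE u mB) (E_norm2 ip_norm hE (A u - _) mB).
rewrite -!E_shift// -/p -/q mulrDr -!exprMn.
by apply: lerD; rewrite ler_sqr ?nnegrE ?mulr_ge0 ?rnorm_ge0 ?(ltW d0).
Qed.

(** On the range of E J the form of A - s is bounded by eta. For a symmetric operator, polarization
    upgrades a bound on the form to a bound on the norm. *)
Lemma E_shift_upper s eta J v : measurable J -> (forall t : R, J t -> `|t - s| <= eta) ->
  E J v = v -> op_dom A v /\ rnorm (A v - s%:C *: v) <= eta * rnorm v.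
Proof.
move=> mJ Js; have AJ u : E J u = u -> op_dom A u.
  move=> <-; apply: (@dom_E_bounded _ _ ip ip_norm _ _ hE J (`|s| + eta)) => // t /Js.
  by have := ler_normD (t - s) s; rewrite subrK; lra.
pose q u := rip (A u - s%:C *: u) u.
have q_le u : E J u = u -> `|q u| <= eta * rnorm u ^+ 2.
  move=> Ju; have Au := AJ _ Ju; rewrite /q rip_shift ler_norml.
  have := @form_ge _ _ ip ip_norm _ _ hE J (s - eta) u mJ Ju Au.
  have := @form_le _ _ ip ip_norm _ _ hE J (s + eta) u mJ Ju Au.
  have h1 (t : R) : J t -> t <= s + eta.
    by move=> /Js; rewrite ler_norml => /andP[]; lra.
  have h2 (t : R) : J t -> s - eta <= t.
    by move=> /Js; rewrite ler_norml => /andP[]; lra.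
  by move=> /(_ h1) + /(_ h2); lra.
move=> Jv; have Av := AJ _ Jv; split=> //.
set w := A v - _; have Jw : E J w = w by rewrite /w -E_shift// Jv.
have [w0|w0] := eqVneq (rnorm w) 0.
  have := q_le _ Jv; rewrite w0.
  have := rnorm_ge0 v; rewrite le_eqVlt => /predU1P[<-|v0]; first by rewrite mulr0.
  move=> /(le_trans (normr_ge0 _)); rewrite pmulr_lge0 ?exprn_gt0// => eta0.
  by rewrite mulr_ge0// ltW.
have [v0|v0] := eqVneq (rnorm v) 0.
  by rewrite /w (rnorm0_eq0 v0) op0 scaler0 subrr rnorm0 mulr0.
have wp : 0 < rnorm w by rewrite lt_def w0 rnorm_ge0.
have vp : 0 < rnorm v by rewrite lt_def v0 rnorm_ge0.
(* The image w rescaled to the length of v: then (w, x) = |v| |w|, and the parallelogram law gives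
   |v + x|^2 + |v - x|^2 = 4 |v|^2. *)
pose x := (rnorm v / rnorm w)%:C *: w.
have xv : rnorm x = rnorm v.
  by rewrite rnormZR ger0_norm ?divfK// divr_ge0// ltW.
have Jx : E J x = x by rewrite /x linearZ/= Jw.
have Ax := AJ _ Jx.
have polar : q (v + x) - q (v - x) = 4 * (rnorm v * rnorm w).
  have wx : rip w x = rnorm v * rnorm w.
    by rewrite ripZr (rip_self ip_norm) expr2 mulrA divfK.
  have xw : rip (A x - s%:C *: x) v = rip w x.
    have Axv : rip (A x) v = rip (A v) x by rewrite ripC /rip (sa_symm sA).
    by rewrite /w 2!ripBl [rip (s%:C *: x) v]ripZl [rip (s%:C *: v) x]ripZl Axv (ripC _ x v).
  have -> : q (v + x) = rip (w + (A x - s%:C *: x)) (v + x).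
    by rewrite /q /w opD// scalerDr opprD addrACA.
  have -> : q (v - x) = rip (w - (A x - s%:C *: x)) (v - x).
    by rewrite /q /w opB// scalerBr subrACA.
  move: xw; set y := A x - _ => xw.
  by rewrite [rip (w + y) _]ripDl [rip (w - y) _]ripBl 2!ripDr 2!ripBr xw wx; lra.
have := q_le (v + x); rewrite linearD/= Jv Jx => /(_ erefl) h1.
have := q_le (v - x); rewrite linearB/= Jv Jx => /(_ erefl) h2.
have := parallelogram ip_norm v x; rewrite xv => par.
have h3 : eta * rnorm (v + x) ^+ 2 + eta * rnorm (v - x) ^+ 2 = 4 * eta * rnorm v ^+ 2.
  by rewrite -mulrDr par; lra.
have : rnorm v * rnorm w <= rnorm v * (eta * rnorm v).
  have := ler_normB (q (v + x)) (q (v - x)); rewrite polar.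
  rewrite ger0_norm ?mulr_ge0 ?rnorm_ge0// => h4.
  by rewrite mulrCA -expr2; lra.
by rewrite ler_pM2l.
Qed.

Lemma gap_resolvent s d : 0 < d -> (forall u, E `]s - d, s + d[%classic u = 0) ->
  resolvent_set A s%:C.
Proof.
move=> d0 E0; apply/(resolventP ip_norm sA); exists d => // u Au.
exact: gap_lower_bound.
Qed.

Lemma eigenvector_localized s d B u : 0 < d -> measurable B -> `]s - d, s + d[ `<=` B ->
  op_dom A u -> A u = s%:C *: u -> E B u = u.
Proof.
move=> d0 mB sB Au us; have mB' := measurableC mB.
have : E (~` B) u = 0.
  apply: rnorm0_eq0; have Aq := dom_E ip_norm hE mB' Au.
  have := @gap_lower_bound s d _ d0 Aq.
  have mJ : measurable (`]s - d, s + d[%classic : set (measurableTypeR R)).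
    exact: measurable_itv.
  rewrite (E_setI ip_norm hE u mJ mB').
  rewrite (_ : _ `&` _ = set0) ; last first.
    by apply/seteqP; split=> // t [/sB].
  rewrite E_shift// us subrr linear0 rnorm0 pmulr_rle0// => /(_ (E_set0 hE u)) h.
  by apply/eqP; rewrite eq_le h rnorm_ge0.
by rewrite (E_setC hE)// => /subr0_eq.
Qed.

End SpectralLocalization.

(** * Vanishing of a spectral mass that is locally small *)

Section Bisection.
Context {R : realType} {H : completeNormedModType R[i]}.
Variables (ip : {dot H for Num.conj}).
Hypothesis ip_norm : forall u : H, `|u| ^+ 2 = ip u u.
Variables (A : linop H H) (E : set R -> {linear H -> H}).
Hypothesis hE : spectral_measure ip A E.
Variable f : H.
Implicit Types (a b s : R) (p : R * R).

(** Closed intervals make nested halves meet in a point. The shared midpoint may be counted twice,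
    so the mass is only subadditive, which suffices. *)
Let phi a b : R := rnorm (E `[a, b]%classic f) ^+ 2.

Let mitv a b : measurable (`[a, b]%classic : set (measurableTypeR R)).
Proof. exact: measurable_itv. Qed.

Let phi_split a b m : a <= m -> m <= b -> phi a b <= phi a m + phi m b.
Proof.
move=> am mb; rewrite {1}/phi (E_norm2 ip_norm hE _ (mitv a m)).
have mC := measurableC (mitv a m).
rewrite (E_setI ip_norm hE f (mitv _ _) (mitv _ _)) (E_setI ip_norm hE f mC (mitv _ _)).
apply: lerD; rewrite ler_sqr ?nnegrE ?rnorm_ge0//.
  by apply: (E_sub_norm ip_norm hE) => //; exact: measurableI.
apply: (E_sub_norm ip_norm hE) => //; first exact: measurableI.
move=> t [/= h]; rewrite !in_itv/= => /andP[at' ->]; rewrite andbT.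
by move/negP: h; rewrite in_itv/= at'/= -ltNge => /ltW.
Qed.

Let step p : R * R := let m := (p.1 + p.2) / 2 in
  if phi m p.2 <= phi p.1 m then (p.1, m) else (m, p.2).

Let stepP p : p.1 <= p.2 ->
  [/\ p.1 <= (step p).1, (step p).1 <= (step p).2, (step p).2 <= p.2,
      (step p).2 - (step p).1 = (p.2 - p.1) / 2 &
      phi p.1 p.2 <= 2 * phi (step p).1 (step p).2].
Proof.
move=> p12; pose m := (p.1 + p.2) / 2.
have m1 : p.1 <= m by rewrite /m; lra.
have m2 : m <= p.2 by rewrite /m; lra.
have := phi_split m1 m2; rewrite /step -/m.
by case: ifP => [|/negbT] /=; rewrite -?ltNge => h; split => //; rewrite /m; lra.
Qed.

(* Bisection keeps half of the mass of f, so the mass of an interval of length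
   (b - a) / 2^n is at least of order 2^-n, against the bound of order 4^-n. *)
Lemma E_locally_small a b : a <= b ->
  (forall s, a <= s <= b -> exists C : R, exists2 e0 : R, 0 < e0 &
    forall e : R, 0 < e -> e < e0 -> rnorm (E `[s - e, s + e]%classic f) <= C * e) ->
  E `[a, b]%classic f = 0.
Proof.
move=> ab loc; apply: contrapT => f0.
pose F n := iter n step (a, b).
have FP n : [/\ a <= (F n).1, (F n).1 <= (F n).2, (F n).2 <= b,
    (F n).2 - (F n).1 = (b - a) / 2 ^+ n & phi a b <= 2 ^+ n * phi (F n).1 (F n).2].
  elim: n => [|n [h1 h2 h3 h4 h5]]; first by rewrite /F/= !expr0 divr1 mul1r.
  have [g1 g2 g3 g4 g5] := stepP h2; rewrite /F iterS -/(F n).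
  split => //; [exact: le_trans g1|exact: le_trans h3| |].
    by rewrite g4 h4 exprS invfM; ring.
  apply: le_trans h5 _; rewrite exprSr -mulrA ler_wpM2l// exprn_ge0//.
have nest n k : (F n).1 <= (F (n + k)%N).1 /\ (F (n + k)%N).2 <= (F n).2.
  elim: k => [|k [h1 h2]]; first by rewrite addn0.
  have [_ h _ _ _] := FP (n + k)%N; have [g1 _ g3 _ _] := stepP h.
  by rewrite addnS /F iterS -/(F _); split; [exact: le_trans g1|exact: le_trans h2].
pose s := sup (range (fun n => (F n).1)).
have ub n : ubound (range (fun n => (F n).1)) (F n).2.
  move=> _ [m _ <-]; have [h1 _] := nest m n; have [_ h2] := nest n m.
  have [_ h _ _ _] := FP (m + n)%N; rewrite addnC in h2.
  by rewrite (le_trans h1)// (le_trans h).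
have sn n : (F n).1 <= s <= (F n).2.
  apply/andP; split.
    apply: ub_le_sup; last by exists n.
    by exists (F 0%N).2; exact: ub.
  by apply: ge_sup; [exists (F 0%N).1, 0%N|exact: ub].
have [C [e0 e00 Ce]] := loc s (sn 0%N).
have c0 : 0 < phi a b.
  rewrite exprn_gt0// lt_def rnorm_ge0 andbT; apply/eqP => /rnorm0_eq0.
  exact: f0.
(* The window radius will be L / 2^n. The added 1 keeps it positive when a = b, and it still covers
   the interval of length (b - a) / 2^n around s. *)
pose L : R := b - a + 1; have L0 : 0 < L by rewrite /L; lra.
pose M : R := C ^+ 2 * L ^+ 2 + 1.
have M0 : 0 < M by rewrite /M ltr_wpDl// mulr_ge0// sqr_ge0.
(* The first bound on 2^-n brings the window below e0. The second contradicts phi a b <= 2^-n C^2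
   L^2. *)
have d0 : 0 < Num.min (e0 / L) (phi a b / M) by rewrite lt_min !divr_gt0.
have [n /(_ _ (leqnn n))] := invS_lt d0.
have t0 : 0 < 2 ^+ n :> R by rewrite exprn_gt0.
have : 2 ^- n <= n.+1%:R^-1 :> R.
  by rewrite lef_pV2 ?posrE// -natrX ler_nat ltn_expl.
move=> /le_lt_trans /[apply]; rewrite lt_min => /andP[].
rewrite !ltr_pdivlMr// => nL nM.
pose e : R := L / 2 ^+ n.
have ee : 0 < e by rewrite divr_gt0.
have ee0 : e < e0 by rewrite /e mulrC.
have := Ce _ ee ee0; have [_ h1 _ h4 h5] := FP n.
have sub : phi (F n).1 (F n).2 <= rnorm (E `[s - e, s + e]%classic f) ^+ 2.
  rewrite ler_sqr ?nnegrE ?rnorm_ge0//; apply: (E_sub_norm ip_norm hE) => //.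
  have le : (F n).2 - (F n).1 <= e.
    by rewrite h4 /e ler_pM2r ?invr_gt0// /L; lra.
  have /andP[s1 s2] := sn n.
  by move=> t /=; rewrite !in_itv/= => /andP[t1 t2]; apply/andP; split; lra.
move=> h; have h0 := rnorm_ge0 (E `[s - e, s + e]%classic f).
have {}h : rnorm (E `[s - e, s + e]%classic f) ^+ 2 <= C ^+ 2 * e ^+ 2.
  by rewrite -exprMn lerXn2r// nnegrE (le_trans h0).
have : phi a b <= 2 ^+ n * (C ^+ 2 * e ^+ 2).
  by apply: le_trans h5 _; rewrite ler_pM2l// (le_trans sub).
have -> : 2 ^+ n * (C ^+ 2 * e ^+ 2) = 2 ^- n * (C ^+ 2 * L ^+ 2).
  by rewrite /e; field; rewrite gt_eqF.
apply/negP; rewrite -ltNge; apply: le_lt_trans nM.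
by rewrite ler_pM2l ?invr_gt0// /M; lra.
Qed.

End Bisection.

(** * The gamma-field and the Weyl function *)

Section InnerProductBounds.
Context {R : realType} {H : completeNormedModType R[i]}.
Variables (ip : {dot H for Num.conj}).
Hypothesis ip_norm : forall u : H, `|u| ^+ 2 = ip u u.
Local Notation rip := (rip ip).

Lemma norm_Im_ip_le (u v : H) : `|complex.Im (ip u v)| <= rnorm u * rnorm v.
Proof.
rewrite (ip_rip ip u v)/=; apply: le_trans (normr_rip_le ip_norm _ _) _.
rewrite rnormZ (_ : cabs 'i%C = 1) ?mul1r//.
by apply/eqP; rewrite -sqrp_eq1 ?cabs_ge0// cabs2/= expr0n add0r expr1n.
Qed.

Lemma rnorm_le_dense (D : set H) (x : H) (M : R) : 0 <= M -> dense D ->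
  (forall h, D h -> rip x h <= M * rnorm h) -> rnorm x <= M.
Proof.
move=> M0 /dense_rnormP dD xD; have := rnorm_ge0 x; rewrite le_eqVlt => /predU1P[<-//|x0].
rewrite -(ler_pM2l x0) -expr2; apply/ler_addgt0Pr => e e0.
have c0 : 0 < rnorm x + M by rewrite ltr_wpDr.
have [h Dh] := dD x (e / (rnorm x + M)) (divr_gt0 e0 c0).
rewrite ltr_pdivlMr// => xh; rewrite -(rip_self ip_norm) -[X in rip x X](subrK h) ripDr.
have h1 := rip_le ip_norm x (x - h); have h2 := xD _ Dh.
have := rnorm_triangle (h - x) x; rewrite subrK rnormB => h3.
by have := ler_wpM2l M0 h3; nra.
Qed.

End InnerProductBounds.

Section BoundaryTriple.
Context {R : realType} {H G : completeNormedModType R[i]}.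
Variables (ipH : {dot H for Num.conj}) (ipG : {dot G for Num.conj}).
Hypothesis ipH_norm : forall u : H, `|u| ^+ 2 = ipH u u.
Hypothesis ipG_norm : forall g : G, `|g| ^+ 2 = ipG g g.
Variables (S T : linop H H) (Gam0 Gam1 : linop H G).
Hypothesis qbt : quasi_boundary_triple ipH ipG S T Gam0 Gam1.

Local Notation A := (A_0 T Gam0).
Local Notation sA := (qbt_selfadjoint qbt).
Local Notation gamma := (gamma_field T Gam0).
Local Notation weyl := (weyl T Gam0 Gam1).
Implicit Types (u v f : H) (g h : G) (z w : R[i]).

Lemma dom_A0P u : op_dom A u <-> op_dom T u /\ Gam0 u = 0.
Proof.
split=> [[Tu [_ u0]]//|[Tu u0]]; split => //; split => //.
by rewrite (qbt_dom0 qbt).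
Qed.

Lemma domG0 u : op_dom T u -> op_dom Gam0 u. Proof. by rewrite (qbt_dom0 qbt). Qed.
Lemma domG1 u : op_dom T u -> op_dom Gam1 u. Proof. by rewrite (qbt_dom1 qbt). Qed.

(** Two elements of ker (T - z) with the same boundary value differ by an element of ker (A_0 - z),
    which is trivial. Hence the partial inverse really inverts [Gam0] there. *)
Lemma gamma_unique z v : resolvent_set A z -> op_dom T v -> T v = z *: v ->
  gamma z (Gam0 v) = v.
Proof.
move=> rz Tv Tvz; apply: pinvKV; last first.
  by rewrite inE; split => //=; rewrite Tvz subrr.
move=> x y; rewrite !inE => -[/= Tx /subr0_eq xz] [/= Ty /subr0_eq yz] xy.
have [c c0 cA] := (resolventP ipH_norm sA z).1 rz.
have Axy : op_dom A (x - y).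
  apply/dom_A0P; split; first exact: op_domB.
  by rewrite opB ?xy ?subrr//; exact: domG0.
have := cA _ Axy; rewrite /= opB// xz yz -scalerBr subrr rnorm0 pmulr_rle0// => h.
by apply: subr0_eq; apply/rnorm0_eq0/eqP; rewrite eq_le h rnorm_ge0.
Qed.

(** Subtracting R(z) (T - z) u from u leaves [Gam0 u] unchanged and lands in ker (T - z): this is
    the decomposition of dom T. *)
Lemma gamma_spec z g : resolvent_set A z -> op_ran Gam0 g ->
  [/\ op_dom T (gamma z g), T (gamma z g) = z *: gamma z g & Gam0 (gamma z g) = g].
Proof.
move=> rz [u]; rewrite (qbt_dom0 qbt) => Tu <-.
have [/dom_A0P[Tr r0] rf] := resolv_spec (T u - z *: u) rz.
set r := resolv _ _ _ in Tr r0 rf; pose v := u - r.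
have Tv : op_dom T v by exact: op_domB.
have v0 : Gam0 v = Gam0 u by rewrite /v opB ?r0 ?subr0//; exact: domG0.
have Tvz : T v = z *: v.
  rewrite /v opB// scalerBr; apply: subr0_eq; rewrite subrACA.
  by rewrite -rf subrr.
by rewrite -v0 gamma_unique.
Qed.

Lemma ran_subspace : linear_subspace (op_ran Gam0).
Proof.
split; first by exists 0; [exact: op_dom0|exact: op0].
move=> a _ _ [u du <-] [v dv <-]; exists (a *: u + v); first exact: op_domP.
exact: opfun_linear.
Qed.

Lemma gammaZ z (a : R[i]) g : resolvent_set A z -> op_ran Gam0 g ->
  gamma z (a *: g) = a *: gamma z g.
Proof.
move=> rz rg; have [h1 h2 h3] := gamma_spec rz rg.
rewrite -{1}h3 -opZ; last exact: domG0.
rewrite gamma_unique//; first exact: op_domZ.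
by rewrite opZ// h2 !scalerA mulrC.
Qed.

Lemma gamma_diff z w g : resolvent_set A z -> resolvent_set A w -> op_ran Gam0 g ->
  gamma z g - gamma w g = (z - w) *: resolv A w (gamma z g).
Proof.
move=> rz rw rg; have [z1 z2 z3] := gamma_spec rz rg; have [w1 w2 w3] := gamma_spec rw rg.
have [r1 r2] := resolv_spec (gamma z g) rw.
have h1 : op_dom A (gamma z g - gamma w g).
  apply/dom_A0P; split; first exact: op_domB.
  by rewrite opB ?z3 ?w3 ?subrr//; exact: domG0.
have [c c0 cA] := (resolventP ipH_norm sA w).1 rw.
apply: (bounded_below_inj c0 cA) => //; first exact: op_domZ.
rewrite [A (_ *: _)]opZ// scalerA (mulrC w) -scalerA -scalerBr r2.
by rewrite /= opB// z2 w2 scalerBr subrACA subrr subr0 scalerBl.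
Qed.

(** Gam1 R(z) is the adjoint of gamma(conj z). In the Green identity one boundary term drops out
    because R(z) f lies in ker Gam0. *)
Lemma gam1_resolv z f h : resolvent_set A z -> op_ran Gam0 h ->
  ipG (Gam1 (resolv A z f)) h = ipH f (gamma (Num.conj z) h).
Proof.
move=> rz rh; have rz' := resolvent_conj ipH_norm sA rz.
have [/dom_A0P[r1 r0] r2] := resolv_spec f rz; have [z1 z2 z3] := gamma_spec rz' rh.
have := qbt_green qbt r1 z1; rewrite z3 r0 ip0l subr0 => <-.
by rewrite z2 ipZr conjCK -ipZl -ipBl -[in RHS]r2.
Qed.

Lemma ran_dense : dense (op_ran Gam0).
Proof.
move=> O [g Og] oO; have := qbt_dense qbt.
move=> /(_ (fst @^-1` O))[||[x y] [/= Ox [u Tu [ux _]]]].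
- by exists (g, 0).
- by apply: open_comp => // p _; exact: cvg_fst.
exists x; split => //; exists u; last by [].
exact: domG0.
Qed.

(** By [gam1_resolv] each f pairs with gamma(z) h to at most |Gam1 R(conj z) f| for |h| <= 1. This
    is a pointwise bound, made uniform by [uniform_boundedness]. *)
Lemma gamma_bounded z : resolvent_set A z ->
  exists C : R, 0 <= C /\ forall h, op_ran Gam0 h -> rnorm (gamma z h) <= C * rnorm h.
Proof.
move=> rz; have rz' := resolvent_conj ipH_norm sA rz.
have [|M MP] := @uniform_boundedness _ _ ipH ipH_norm
    [set gamma z h | h in [set h | op_ran Gam0 h /\ rnorm h <= 1]].
  move=> f; exists (rnorm (Gam1 (resolv A (Num.conj z) f))) => _ [h [rh h1] <-].
  rewrite /rip -[z in gamma z]conjCK -gam1_resolv//.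
  apply: le_trans (normr_rip_le ipG_norm _ _) _.
  by rewrite ler_piMr ?rnorm_ge0.
exists `|M|; split=> // h rh; have [h0|h0] := eqVneq (rnorm h) 0.
  rewrite (rnorm0_eq0 h0) rnorm0 mulr0.
  have := gamma_unique rz (op_dom0 T); rewrite !op0 scaler0 => -> //.
  by rewrite rnorm0.
have hp : 0 < rnorm h by rewrite lt_def h0 rnorm_ge0.
have /MP : [set gamma z h | h in [set h | op_ran Gam0 h /\ rnorm h <= 1]]
    (gamma z ((rnorm h)^-1%:C *: h)).
  exists ((rnorm h)^-1%:C *: h) => //; split.
    by apply: subspaceZ => //; exact: ran_subspace.
  by rewrite rnormZR ger0_norm ?invr_ge0 ?(ltW hp)// mulVf.
rewrite gammaZ// rnormZR ger0_norm ?invr_ge0 ?(ltW hp)// mulrC ler_pdivrMr// => /le_trans; apply.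
by rewrite ler_pM2r// ler_norm.
Qed.

Lemma gam1_resolv_bounded z : resolvent_set A z ->
  exists C : R, 0 <= C /\ forall f, rnorm (Gam1 (resolv A z f)) <= C * rnorm f.
Proof.
move=> rz; have rz' := resolvent_conj ipH_norm sA rz.
have [C [C0 CP]] := gamma_bounded rz'; exists C; split=> // f.
apply: (rnorm_le_dense ipG_norm _ ran_dense) => [|h rh]; first by rewrite mulr_ge0 ?rnorm_ge0.
rewrite /rip gam1_resolv//; apply: le_trans (rip_le ipH_norm _ _) _.
rewrite mulrAC mulrC -mulrA mulrCA mulrC.
by have := CP _ rh; have := rnorm_ge0 f; nra.
Qed.

Lemma resolv_gam1_dom z f : resolvent_set A z -> op_dom T (resolv A z f).
Proof. by move=> rz; have [/dom_A0P[]] := resolv_spec f rz. Qed.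

Lemma weyl_diff z w g : resolvent_set A z -> resolvent_set A w -> op_ran Gam0 g ->
  weyl z g - weyl w g = (z - w) *: Gam1 (resolv A w (gamma z g)).
Proof.
move=> rz rw rg; have [z1 _ _] := gamma_spec rz rg; have [w1 _ _] := gamma_spec rw rg.
rewrite /Defs.weyl -opB; [|exact: domG1|exact: domG1].
by rewrite gamma_diff// opZ//; apply/domG1/resolv_gam1_dom.
Qed.

(** Two cases matter: for w = conj z the right-hand side vanishes, so M(conj z) is formally adjoint
    to M(z); for w = z it is 2 i Im z times an inner product of gamma-field values. *)
Lemma weyl_green z w g h : resolvent_set A z -> resolvent_set A w ->
  op_ran Gam0 g -> op_ran Gam0 h ->
  ipG (weyl z g) h - ipG g (weyl w h) = (z - Num.conj w) * ipH (gamma z g) (gamma w h).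
Proof.
move=> rz rw rg rh; have [z1 z2 z3] := gamma_spec rz rg.
have [w1 w2 w3] := gamma_spec rw rh.
have := qbt_green qbt z1 w1; rewrite z3 w3 z2 w2 ipZl ipZr => <-.
by rewrite mulrBl.
Qed.

End BoundaryTriple.

(** * Analytic continuation of the Weyl function and eigenvalues *)

Section Continuation.
Context {R : realType} {H G : completeNormedModType R[i]}.
Variables (ipH : {dot H for Num.conj}) (ipG : {dot G for Num.conj}).
Hypothesis ipH_norm : forall u : H, `|u| ^+ 2 = ipH u u.
Hypothesis ipG_norm : forall g : G, `|g| ^+ 2 = ipG g g.
Variables (S T : linop H H) (Gam0 Gam1 : linop H G).
Hypothesis qbt : quasi_boundary_triple ipH ipG S T Gam0 Gam1.

Local Notation A := (A_0 T Gam0).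
Local Notation sA := (qbt_selfadjoint qbt).
Local Notation gamma := (gamma_field T Gam0).
Local Notation weyl := (weyl T Gam0 Gam1).
Implicit Types (u v f : H) (g h : G) (z w : R[i]) (l s : R).

Lemma nbhs_complexP (O : set R[i]^o) (z : R[i]^o) :
  nbhs z O <-> exists2 e : R, 0 < e & forall w : R[i], cabs (w - z) < e -> O w.
Proof.
split=> [/nbhs_ballP[e /= /gt0_complex[e0 ee] eO]|[e e0 eO]].
  exists (complex.Re e) => // w; rewrite -ltcR -cabsE ee => wz.
  by apply: eO; rewrite -ball_normE/= distrC.
apply/nbhs_ballP; exists e%:C; first by rewrite /= ltcE/= eqxx.
by move=> w; rewrite -ball_normE/= distrC cabsE ltcR; exact: eO.
Qed.

Lemma resolvent_ball z : resolvent_set A z ->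
  exists2 c : R, 0 < c & forall w, cabs (w - z) < c ->
    resolvent_set A w /\ forall f, c * rnorm (resolv A w f) <= rnorm f.
Proof.
move=> /(resolventP ipH_norm sA)[c c0 cA]; exists (c / 2); first by rewrite divr_gt0.
move=> w wz; have := bounded_below_near w cA => wA.
have cw : c / 2 <= c - cabs (w - z) by move: wz; lra.
have rw : resolvent_set A w.
  apply/(resolventP ipH_norm sA); exists (c - cabs (w - z)) => //.
  by apply: lt_le_trans cw; rewrite divr_gt0.
split=> // f; have [Ar rf] := resolv_spec f rw.
by rewrite -{2}rf; apply: le_trans (wA _ Ar); rewrite ler_wpM2r ?rnorm_ge0.
Qed.

Lemma resolvent_open : open (resolvent_set A : set R[i]^o).
Proof.
rewrite openE => z /resolvent_ball[c c0 cP]; apply/nbhs_complexP.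
by exists c => // w /cP[].
Qed.

Lemma derivable1P (F : R[i]^o -> G) (z : R[i]) (L : G) :
  (forall e : R, 0 < e -> exists2 d : R, 0 < d & forall w : R[i], w != 0 -> cabs w < d ->
    rnorm (L - w^-1 *: (F (z + w) - F z)) < e) <->
  (fun h : R[i]^o => h^-1 *: ((F \o shift (z : R[i]^o)) (h *: (1 : R[i]^o)) - F z)) @ 0^' --> L.
Proof.
have eq w : (F \o shift (z : R[i]^o)) (w *: (1 : R[i]^o)) = F (z + w).
  by rewrite /= /shift/= addrC; congr (F (_ + _)); rewrite /GRing.scale/= mulr1.
split=> [FL|/cvgrPdist_lt FL e e0].
  apply/cvgrPdist_lt => e /gt0_complex[e0 ee]; have [d d0 dP] := FL _ e0.
  apply/nbhs_complexP; exists d => // w; rewrite subr0 => wd w0.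
  by rewrite eq normE -ee ltcR dP.
have [|d d0 dP] := (nbhs_complexP _ _).1 (FL e%:C _); first by rewrite ltcE/= eqxx.
exists d => // w w0 wd; have := dP w; rewrite subr0 => /(_ wd w0).
by rewrite eq normE ltcR.
Qed.

(** M is its own continuation on the whole resolvent set, with derivative Gam1 R(z) gamma(z). *)
Lemma resolvent_continuable l : resolvent_set A l%:C -> weyl_continuable T Gam0 Gam1 l.
Proof.
move=> rl; exists (resolvent_set A); split=> //; first exact: resolvent_open.
move=> g rg; exists (fun z => weyl z g); split=> // z rz.
have [c c0 cP] := resolvent_ball rz.
have [C [C0 CP]] := gam1_resolv_bounded ipH_norm ipG_norm qbt rz.
apply/cvg_ex; exists (Gam1 (resolv A z (gamma z g))); apply/derivable1P => e e0.
pose B := rnorm (gamma z g).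
have B0 : 0 <= B := rnorm_ge0 _.
have D0 : 0 < C * B + 1 by rewrite ltr_wpDl// mulr_ge0.
(* The error of the difference quotient is at most C |w| |R(z + w) gamma(z) g| <= C |w| B / c. *)
exists (Num.min c (e * c / (C * B + 1))); first by rewrite lt_min c0 divr_gt0 ?mulr_gt0.
move=> w w0; rewrite lt_min => /andP[wc]; rewrite ltr_pdivlMr// => we.
have [|rw rwP] := cP (z + w); first by rewrite addrAC subrr add0r.
rewrite (weyl_diff ipH_norm qbt)// addrAC subrr add0r scalerA mulVf// scale1r.
rewrite -opB; [|exact/(domG1 qbt)/(resolv_gam1_dom qbt)|exact/(domG1 qbt)/(resolv_gam1_dom qbt)].
rewrite -(resolvB ipH_norm sA)//.
apply: le_lt_trans (CP _) _; rewrite (gamma_diff ipH_norm qbt)//.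
rewrite opprD addrA subrr sub0r scaleNr rnormN rnormZ -(ltr_pM2l c0).
have := ler_wpM2l (mulr_ge0 C0 (cabs_ge0 w)) (rwP (gamma z g)); rewrite -/B.
move: (rnorm _) => r h; have := cabs_ge0 w => w1.
by nra.
Qed.

Section Point.
Variables (E : set R -> {linear H -> H}).
Hypothesis hE : spectral_measure ipH A E.

Lemma weyl_Im_diff s (eta : R) g : 0 < eta -> op_ran Gam0 g ->
  2 * eta * rnorm (gamma (s +i* eta)%C g) ^+ 2 =
  complex.Im (ipG g (weyl (s -i* eta)%C g - weyl (s +i* eta)%C g)).
Proof.
move=> e0 rg; set z := (s +i* eta)%C.
have rz : resolvent_set A z by apply: (nonreal_resolvent ipH_norm sA); rewrite /= gt_eqF.
have rz' := resolvent_conj ipH_norm sA rz.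
have zz : Num.conj z = (s -i* eta)%C by [].
have h1 := weyl_green ipH_norm qbt rz rz' rg rg.
have h2 := weyl_green ipH_norm qbt rz rz rg rg.
move: h1; rewrite conjCK subrr mul0r => /subr0_eq h1.
rewrite -zz ipBr -h1 h2 zz (ip_self ipH_norm) /=.
by ring.
Qed.

Lemma weyl_Im s (eta : R) g : 0 < eta -> op_ran Gam0 g ->
  eta * rnorm (gamma (s +i* eta)%C g) ^+ 2 = complex.Im (ipG (weyl (s +i* eta)%C g) g).
Proof.
move=> e0 rg; set z := (s +i* eta)%C.
have rz : resolvent_set A z by apply: (nonreal_resolvent ipH_norm sA); rewrite /= gt_eqF.
have h2 := weyl_green ipH_norm qbt rz rz rg rg; move: h2.
rewrite [ipG g _]ipC conjCE (ip_self ipH_norm).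
case: (ipG _ _) => a b /= [_].
by rewrite mulr0; lra.
Qed.

Lemma gamma_locally_bounded (O : set R[i]^o) (F : R[i]^o -> G) s g :
  op_ran Gam0 g -> nbhs (s%:C : R[i]^o) O -> derivable F s%:C 1 ->
  (forall z, O z -> resolvent_set A z -> F z = weyl z g) ->
  exists K : R, exists2 e0 : R, 0 < e0 & forall eta : R, 0 < eta -> eta < e0 ->
    rnorm (gamma (s +i* eta)%C g) <= K.
Proof.
move=> rg /nbhs_complexP[d1 d10 dO] /cvg_ex[L /derivable1P FL] FM.
have [d2 d20 dL] := FL 1 ltr01.
(* Derivability with tolerance 1 gives Lipschitz constant |L| + 1 at s, whence |gamma|^2 <= |g| (|L|
   + 1); the last 1 comes from x <= x^2 + 1. *)
exists (rnorm g * (rnorm L + 1) + 1), (Num.min d1 d2); first by rewrite lt_min d10.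
move=> eta eta0; rewrite lt_min => /andP[ed1 ed2].
have lip (t : R) : `|t| = eta ->
    rnorm (weyl (s +i* t)%C g - F s%:C) <= eta * (rnorm L + 1).
  move=> te; have t0 : t != 0 by rewrite -normr_eq0 te gt_eqF.
  pose w := (0 +i* t)%C : R[i].
  have w0 : w != 0 by rewrite eq_complex/= negb_and t0 orbT.
  have wt : cabs w = eta by rewrite cabs_i.
  have rz : resolvent_set A (s +i* t)%C by exact: (nonreal_resolvent ipH_norm sA).
  rewrite -FM//; last by apply: dO; rewrite complex_line addrAC subrr add0r wt.
  have := dL w w0; rewrite wt => /(_ ed2); rewrite complex_line -/w.
  set D := F _ - F _ => h.
  have -> : D = w *: (w^-1 *: D) by rewrite scalerA mulfV// scale1r.
  rewrite rnormZ wt ler_wpM2l ?(ltW eta0)//.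
  rewrite -(subrK L (_ *: D)); apply: le_trans (rnorm_triangle _ _) _.
  by rewrite rnormB; move: h; lra.
have := weyl_Im_diff s eta0 rg; have := lip eta (gtr0_norm eta0).
have := lip (- eta); rewrite normrN gtr0_norm// => /(_ erefl) h1 h2 h3.
have := norm_Im_ip_le ipG_norm g (weyl (s -i* eta)%C g - weyl (s +i* eta)%C g).
rewrite -h3 ger0_norm; last by rewrite !mulr_ge0 ?exprn_ge0 ?rnorm_ge0// ltW.
set X := weyl (s -i* eta)%C g in h1 *; set Y := weyl (s +i* eta)%C g in h2 *.
have h4 : rnorm (X - Y) <= 2 * eta * (rnorm L + 1).
  have -> : X - Y = (X - F s%:C) + (F s%:C - Y) by rewrite addrA subrK.
  by apply: le_trans (rnorm_triangle _ _) _; rewrite (rnormB _ Y); lra.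
move=> h5; set x := rnorm (gamma _ g) in h3 h5 *.
have : 2 * eta * x ^+ 2 <= 2 * eta * (rnorm g * (rnorm L + 1)).
  apply: le_trans h5 _; rewrite [leRHS]mulrCA ler_wpM2l ?rnorm_ge0//.
rewrite ler_pM2l ?mulr_gt0// => h6.
have : 0 <= x by exact: rnorm_ge0.
by nra.
Qed.

(** Of the factor 2 eta, one eta bounds A_0 - s on the window and the other is the term i eta; the
    quotient by |Im nu| bounds R(nu). *)
Lemma E_gamma_small (s eta : R) nu g : 0 < eta -> complex.Im nu != 0 -> op_ran Gam0 g ->
  rnorm (E `[s - eta, s + eta]%classic (gamma nu g)) <=
  2 * eta * (rnorm (gamma (s +i* eta)%C g) / `|complex.Im nu|).
Proof.
move=> eta0 nu0 rg; set J : set (measurableTypeR R) := `[_, _]%classic.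
have mJ : measurable J by exact: measurable_itv.
set z := (s +i* eta)%C.
have rz : resolvent_set A z by apply: (nonreal_resolvent ipH_norm sA); rewrite /= gt_eqF.
have rnu : resolvent_set A nu by exact: (nonreal_resolvent ipH_norm sA).
pose r := resolv A nu (gamma z g).
have [Ar rf] := resolv_spec (gamma z g) rnu; rewrite -/r in Ar rf.
have gnu : gamma nu g = A r - z *: r.
  have /eqP := gamma_diff ipH_norm qbt rz rnu rg; rewrite -/r subr_eq => /eqP h.
  have {h} : gamma nu g = gamma z g - (z - nu) *: r by rewrite h addrAC subrr add0r.
  by rewrite -rf scalerBl opprB addrA subrK.
have r_le : rnorm r <= rnorm (gamma z g) / `|complex.Im nu|.
  rewrite ler_pdivlMr ?normr_gt0// mulrC -rf.
  by apply: (nonreal_bounded_below ipH_norm) => // u Au; exact: (sa_symm sA).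
have [Av Avs] : op_dom A (E J r) /\
    rnorm (A (E J r) - s%:C *: E J r) <= eta * rnorm (E J r).
  apply: (E_shift_upper ipH_norm sA hE mJ); last exact: (E_idem hE).
  by move=> t; rewrite /J/= in_itv/= => /andP[t1 t2]; rewrite ler_norml; apply/andP; split; lra.
rewrite gnu -(E_shift ipH_norm sA hE)//.
rewrite (_ : z *: E J r = s%:C *: E J r + (0 +i* eta)%C *: E J r); last first.
  by rewrite /z complex_line scalerDl.
rewrite opprD addrA.
apply: le_trans (rnorm_triangle _ _) _; rewrite rnormN rnormZ cabs_i gtr0_norm//.
have := E_le ipH_norm hE r mJ => h.
have : eta * rnorm (E J r) <= eta * (rnorm (gamma z g) / `|complex.Im nu|).
  by rewrite ler_pM2l// (le_trans h).
by move: Avs; lra.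
Qed.

Variable Delta : set R.
Hypothesis Delta_open : open Delta.
Hypothesis Delta_simple : forall u, E Delta u = u ->
  (forall nu g, complex.Im nu != 0 -> op_ran Gam0 g -> ipH u (gamma nu g) = 0) -> u = 0.
Variable l : R.
Hypothesis Dl : Delta l.

Let mDelta : measurable (Delta : set (measurableTypeR R)).
Proof. exact: open_measurable. Qed.

Let Delta_ball : exists2 d : R, 0 < d & `]l - d, l + d[ `<=` Delta.
Proof.
have : nbhs l Delta by exact: open_nbhs_nbhs.
move/nbhs_ballP => [d /= d0 dD]; exists d => // t /=.
rewrite in_itv/= => /andP[t1 t2]; apply: dD.
by rewrite -ball_normE/= ltr_norml; apply/andP; split; lra.
Qed.

Lemma continuable_resolvent : weyl_continuable T Gam0 Gam1 l -> resolvent_set A l%:C.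
Proof.
move=> [U [oU Ul UP]]; have [d1 d10 d1D] := Delta_ball.
have /nbhs_complexP[d2 d20 d2U] : nbhs (l%:C : R[i]^o) U by exact: open_nbhs_nbhs.
(* Halving keeps the closed interval [l - d, l + d] strictly inside both Delta and the domain of the
   continuation. *)
pose d := Num.min d1 d2 / 2.
have m0 : 0 < Num.min d1 d2 by rewrite lt_min d10.
have d0 : 0 < d by rewrite divr_gt0.
have [dd1 dd2] : d < d1 /\ d < d2.
  have : Num.min d1 d2 <= d1 by rewrite ge_min lexx.
  have : Num.min d1 d2 <= d2 by rewrite ge_min lexx orbT.
  by rewrite /d; split; lra.
pose J : set (measurableTypeR R) := `[l - d, l + d]%classic.
have mJ : measurable J by exact: measurable_itv.
have Jg nu g : complex.Im nu != 0 -> op_ran Gam0 g -> E J (gamma nu g) = 0.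
  move=> nu0 rg; have [F [Fan FM]] := UP g rg.
  apply: (E_locally_small ipH_norm hE) => [|s /andP[s1 s2]]; first by lra.
  have Us : U s%:C.
    apply: d2U; rewrite -rmorphB cabsR ltr_norml; apply/andP; split; lra.
  have [|K [e0 e00 KP]] := gamma_locally_bounded rg _ (Fan _ Us) FM.
    exact: open_nbhs_nbhs.
  exists (2 * (K / `|complex.Im nu|)), e0 => // e ee ee0.
  apply: le_trans (E_gamma_small s ee nu0 rg) _.
  have i0 : 0 <= `|complex.Im nu|^-1 by rewrite invr_ge0.
  by have := ler_wpM2l (ltW ee) (ler_wpM2r i0 (KP _ ee ee0)); lra.
apply: (gap_resolvent ipH_norm sA hE d0) => v.
have mJ0 : measurable (`]l - d, l + d[%classic : set (measurableTypeR R)).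
  exact: measurable_itv.
apply: (E_sub0 ipH_norm hE mJ mJ0).
  by move=> t; rewrite /J/= !in_itv/= => /andP[t1 t2]; apply/andP; split; lra.
(* E J v lies in the range of E Delta, and (E J v, gamma(nu) g) = (v, E J gamma(nu) g) = 0. *)
apply: Delta_simple => [|nu g nu0 rg].
  apply: (E_sub ipH_norm hE) => // t; rewrite /J/= in_itv/= => /andP[t1 t2].
  by apply: d1D; rewrite /= in_itv/=; apply/andP; split; lra.
by rewrite (E_sym hE)// Jg// ip0r.
Qed.

Lemma slim0_not_eigenvalue : weyl_slim0 T Gam0 Gam1 l -> ~ point_spectrum A l%:C.
Proof.
move=> slim [u [/= Au /subr0_eq uE] /eqP]; apply.
have [d d0 dD] := Delta_ball.
have Du : E Delta u = u by exact: (eigenvector_localized ipH_norm sA hE d0 mDelta dD).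
have [Tu u0] := (dom_A0P qbt u).1 Au.
have form nu g : resolvent_set A nu -> op_ran Gam0 g ->
    ipG (Gam1 u) g = (l%:C - Num.conj nu) * ipH u (gamma nu g).
  move=> rnu rg; have [g1 g2 g3] := gamma_spec ipH_norm qbt rnu rg.
  have := qbt_green qbt Tu g1; rewrite u0 g3 ip0l subr0 => <-.
  by rewrite g2 ipZr -/(A u) uE ipZl mulrBl.
have G1u g : op_ran Gam0 g -> ipG (Gam1 u) g = 0.
  move=> rg; apply: ip_orth => a.
  have : op_ran Gam0 (a *: g) by apply: subspaceZ => //; exact: ran_subspace.
  move: {rg} (a *: g) => {}g rg.
  apply/eqP; rewrite -sqrf_eq0 eq_le sqr_ge0 andbT; apply/ler_addgt0Pr => e e0.
  (* The estimate ends with |(Gam1 u, g)|^2 <= |u|^2 |g| e / K. A single eta below the threshold of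
     the limit is enough, since the left-hand side does not depend on eta. *)
  rewrite add0r; pose K : R := rnorm u ^+ 2 * rnorm g + 1.
  have K0 : 0 < K by rewrite ltr_wpDl// mulr_ge0 ?exprn_ge0 ?rnorm_ge0.
  have eK : 0 < (e / K)%:C by rewrite ltcE/= eqxx divr_gt0.
  have /cvgrPdist_lt/(_ _ eK)[d' /= d'0 /(_ (d' / 2))] := slim g rg.
  have d'2 : 0 < d' / 2 by rewrite divr_gt0.
  rewrite /= sub0r normrN gtr0_norm// => /(_ ltac:(by lra) d'2).
  rewrite sub0r normrN normE ltcR rnormZ cabs_i gtr0_norm//.
  move: (d' / 2) d'2 => eta eta0; set W := weyl _ g => We.
  pose z := (l +i* eta)%C : R[i].
  have rz : resolvent_set A z by apply: (nonreal_resolvent ipH_norm sA); rewrite /= gt_eqF.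
  have gz := weyl_Im l eta0 rg; rewrite -/W -/z in gz.
  have h1 : `|rip ipG (Gam1 u) g| <= eta * (rnorm u * rnorm (gamma z g)).
    rewrite /rip (form z)// /z conjCE/=.
    have := norm_Im_ip_le ipH_norm u (gamma z g); rewrite /z.
    case: (ipH _ _) => a' b' /= h.
    rewrite subrr mul0r !sub0r opprK normrN normrM gtr0_norm//.
    by rewrite ler_pM2l.
  have h2 : (eta * rnorm (gamma z g)) ^+ 2 <= e / K * rnorm g.
    rewrite exprMn expr2 -mulrA gz.
    apply: (@le_trans _ _ (eta * (rnorm W * rnorm g))).
      by rewrite ler_pM2l// (le_trans (ler_norm _))// norm_Im_ip_le.
    by rewrite mulrA ler_wpM2r ?rnorm_ge0// ltW.
  rewrite -(real_normK (num_real _)).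
  apply: (@le_trans _ _ (rnorm u ^+ 2 * (eta * rnorm (gamma z g)) ^+ 2)).
    rewrite -exprMn mulrCA; apply: lerXn2r; rewrite ?nnegrE//.
    by rewrite !mulr_ge0 ?rnorm_ge0// ltW.
  apply: le_trans (ler_wpM2l (sqr_ge0 (rnorm u)) h2) _.
  rewrite mulrCA mulrAC ler_pdivrMr// ler_pM2l// /K; lra.
(* With Gam1 u orthogonal to ran Gam0, [form] at nonreal nu leaves (l - conj nu) (u, gamma(nu) g) =
   0 with a nonzero factor. *)
apply: Delta_simple => // nu g nu0 rg.
have rnu : resolvent_set A nu by exact: (nonreal_resolvent ipH_norm sA).
have /esym/eqP := form nu g rnu rg; rewrite G1u// mulf_eq0 => /orP[|/eqP//].
rewrite conjCE subr_eq0 eq_complex/= => /andP[_]; rewrite eq_sym oppr_eq0.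
by rewrite (negbTE nu0).
Qed.

End Point.

End Continuation.

(** * The strong limit at points that are not eigenvalues *)

Section StrongLimit.
Context {R : realType} {H G : completeNormedModType R[i]}.
Variables (ipH : {dot H for Num.conj}) (ipG : {dot G for Num.conj}).
Hypothesis ipH_norm : forall u : H, `|u| ^+ 2 = ipH u u.
Hypothesis ipG_norm : forall g : G, `|g| ^+ 2 = ipG g g.
Variables (S T : linop H H) (Gam0 Gam1 : linop H G).
Hypothesis qbt : quasi_boundary_triple ipH ipG S T Gam0 Gam1.

Local Notation A := (A_0 T Gam0).
Local Notation sA := (qbt_selfadjoint qbt).
Local Notation gamma := (gamma_field T Gam0).
Local Notation weyl := (weyl T Gam0 Gam1).
Implicit Types (u v f : H) (g h : G) (z w : R[i]) (l s : R).

Lemma closure_subspace (L : set H) : linear_subspace L -> linear_subspace (closure L).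
Proof.
move=> [L0 Llin]; split; first exact: subset_closure.
move=> a u v /closure_rnormP Lu /closure_rnormP Lv; apply/closure_rnormP => e e0.
have a0 := cabs_ge0 a; have a1 : 0 < cabs a + 1 by rewrite ltr_wpDl.
have e2 : 0 < e / 2 by rewrite divr_gt0.
have [x Lx] := Lu _ (divr_gt0 e2 a1); rewrite ltr_pdivlMr// => ux.
have [y Ly vy] := Lv _ e2.
exists (a *: x + y); first exact: Llin.
rewrite opprD addrACA -scalerBr; apply: le_lt_trans (rnorm_triangle _ _) _.
by rewrite rnormZ; have := rnorm_ge0 (u - x); nra.
Qed.

(** The orthogonal complement of the range of A_0 - l is its kernel, since l is real; no eigenvector
    means a dense range. *)
Lemma noneigenvalue_range l u (e : R) : ~ point_spectrum A l%:C -> 0 < e ->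
  exists2 v, op_dom A v & rnorm (u - (A v - l%:C *: v)) < e.
Proof.
move=> nl e0; pose L := op_ran (op_shift A l%:C).
have : closure L u.
  apply: (orthogonal_setT ipH_norm); first exact/closure_subspace/range_subspace.
    exact: closed_closure.
  move=> f fL; have [Af Afl] : op_dom A f /\ A f = l%:C *: f.
    apply: (sa_adj sA) => v Av; apply: subr0_eq.
    rewrite ipZr conjCE/= oppr0 -/(l%:C) -ipZl -ipBl; apply: ip_eq0C; apply: fL.
    by apply: subset_closure; exists v.
  apply: contrapT => /eqP f0; apply: nl; exists f => //.
  by split => //=; rewrite -/(A f) Afl subrr.
by move=> /closure_rnormP/(_ e e0)[_ [v Av <-] uv]; exists v.
Qed.

Lemma eta_resolv_le l (eta : R) f : 0 < eta ->
  eta * rnorm (resolv A (l +i* eta)%C f) <= rnorm f.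
Proof.
move=> eta0; have rz : resolvent_set A (l +i* eta)%C.
  by apply: (nonreal_resolvent ipH_norm sA); rewrite /= gt_eqF.
have [r1 r2] := resolv_spec f rz.
have := @nonreal_bounded_below _ _ ipH ipH_norm A (l +i* eta)%C _ _ r1.
rewrite r2 /= gtr0_norm//; apply => u Au; exact: (sa_symm sA).
Qed.

(** On y = (A_0 - l) v one has R(z) y = v + i eta R(z) v, of norm at most 2 |v|. Such y are dense
    and eta R(z) is a contraction. *)
Lemma eta_resolv_cvg l f (e : R) : ~ point_spectrum A l%:C -> 0 < e ->
  exists2 d : R, 0 < d & forall eta : R, 0 < eta -> eta < d ->
    eta * rnorm (resolv A (l +i* eta)%C f) <= e.
Proof.
move=> nl e0; have e2 : 0 < e / 2 by rewrite divr_gt0.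
have [v Av fv] := noneigenvalue_range f nl e2.
have v0 := rnorm_ge0 v.
have c0 : 0 < 4 * (rnorm v + 1) by rewrite mulr_gt0// ltr_wpDl.
exists (e / (4 * (rnorm v + 1))); first by rewrite divr_gt0.
move=> eta eta0; rewrite ltr_pdivlMr// => etad.
set z := (l +i* eta)%C; set y := A v - _ in fv.
have rz : resolvent_set A z by apply: (nonreal_resolvent ipH_norm sA); rewrite /= gt_eqF.
have yv : resolv A z y = v + (0 +i* eta)%C *: resolv A z v.
  have [r1 r2] := resolv_spec v rz.
  have Ar : op_dom A ((0 +i* eta)%C *: resolv A z v) by exact: op_domZ.
  apply/esym/(resolv_unique ipH_norm sA rz); first exact: op_domD.
  rewrite opD// [A (_ *: _)]opZ// scalerDr opprD addrACA scalerA (mulrC z) -scalerA.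
  rewrite -scalerBr r2 /y /z complex_line scalerDl opprD addrA -addrA addNr addr0.
  by [].
have -> : resolv A z f = resolv A z (f - y) + resolv A z y.
  by rewrite (resolvB ipH_norm sA)// subrK.
have h1 : eta * rnorm (resolv A z (f - y)) <= rnorm (f - y) by exact: eta_resolv_le.
have h2 : eta * rnorm (resolv A z v) <= rnorm v by exact: eta_resolv_le.
have h3 : rnorm (resolv A z y) <= 2 * rnorm v.
  rewrite yv; apply: le_trans (rnorm_triangle _ _) _.
  by rewrite rnormZ cabs_i gtr0_norm//; lra.
have := ler_wpM2l (ltW eta0) (rnorm_triangle (resolv A z (f - y)) (resolv A z y)).
have := ler_wpM2l (ltW eta0) h3.
by nra.
Qed.

(** M(z) and gamma(z) are expressed through their values at the base point w = l + i. Then eta M(z)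
    g is O(eta) up to a multiple of eta R(z) gamma(w) g, which [eta_resolv_cvg] makes small. *)
Lemma noneigenvalue_slim0 l : ~ point_spectrum A l%:C -> weyl_slim0 T Gam0 Gam1 l.
Proof.
move=> nl g rg; pose w := (l +i* 1)%C : R[i].
have rw : resolvent_set A w.
  by apply: (nonreal_resolvent ipH_norm sA); rewrite /= oner_eq0.
have [C [C0 CP]] := gam1_resolv_bounded ipH_norm ipG_norm qbt rw.
apply/cvgrPdist_lt => e' /gt0_complex[]; set e := complex.Re e' => e0 <-.
pose a := rnorm (weyl w g); pose b := rnorm (gamma w g).
have a0 : 0 <= a := rnorm_ge0 _; have b0 : 0 <= b := rnorm_ge0 _.
have C1 : 0 < 2 * (C + 1) by rewrite mulr_gt0// ltr_wpDl.
have [d d0 dP] := eta_resolv_cvg (gamma w g) nl (divr_gt0 e0 C1).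
have K0 : 0 < 2 * (a + C * b + 1) by rewrite mulr_gt0// ltr_wpDl// addr_ge0// mulr_ge0.
pose K := e / (2 * (a + C * b + 1)).
have K1 : 0 < K by rewrite divr_gt0.
near=> eta.
have eta0 : 0 < eta by near: eta; exact: nbhs_right_gt.
have etad : eta < d by near: eta; exact: nbhs_right_lt.
have eta1 : eta < 1 by near: eta; exact: nbhs_right_lt.
have : eta < K by near: eta; exact: nbhs_right_lt.
rewrite /K ltr_pdivlMr// => etaK.
rewrite sub0r normrN normE ltcR rnormZ cabs_i gtr0_norm//.
set z := (l +i* eta)%C.
have rz : resolvent_set A z by apply: (nonreal_resolvent ipH_norm sA); rewrite /= gt_eqF.
have zw : cabs (z - w) <= 1.
  have -> : z - w = (0 +i* (eta - 1))%C by apply/eqP; rewrite eq_complex/= subrr !eqxx.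
  by rewrite cabs_i ler_norml; apply/andP; split; lra.
have := dP _ eta0 etad; rewrite -/z ler_pdivlMr//.
set rho := rnorm (resolv _ _ _) => hr.
have rho0 : 0 <= rho := rnorm_ge0 _.
have h1 : rnorm (gamma z g) <= b + rho.
  have /eqP := gamma_diff ipH_norm qbt rw rz rg; rewrite subr_eq => /eqP h.
  have -> : gamma z g = gamma w g + (z - w) *: resolv A z (gamma w g).
    by rewrite {1}h -opprB scaleNr addrAC addNr add0r.
  apply: le_trans (rnorm_triangle _ _) _; rewrite lerD2l rnormZ.
  by rewrite ler_piMl.
have h2 : rnorm (weyl z g) <= a + C * (b + rho).
  have -> : weyl z g = weyl w g + (z - w) *: Gam1 (resolv A w (gamma z g)).
    by rewrite -(weyl_diff ipH_norm qbt)// addrC subrK.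
  apply: le_trans (rnorm_triangle _ _) _; rewrite lerD2l rnormZ.
  apply: (@le_trans _ _ (rnorm (Gam1 (resolv A w (gamma z g))))).
    by rewrite ler_piMl ?rnorm_ge0.
  by apply: le_trans (CP _) _; rewrite ler_wpM2l.
apply: le_lt_trans (ler_wpM2l (ltW eta0) h2) _.
by nra.
Unshelve. all: by end_near. Qed.

End StrongLimit.

(** * Simple operators *)

Section SimpleOperator.
Context {R : realType} {H G : completeNormedModType R[i]}.
Variables (ipH : {dot H for Num.conj}) (ipG : {dot G for Num.conj}).
Hypothesis ipH_norm : forall u : H, `|u| ^+ 2 = ipH u u.
Hypothesis ipG_norm : forall g : G, `|g| ^+ 2 = ipG g g.
Variables (S T : linop H H) (Gam0 Gam1 : linop H G).
Hypothesis qbt : quasi_boundary_triple ipH ipG S T Gam0 Gam1.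

Local Notation A := (A_0 T Gam0).
Local Notation sA := (qbt_selfadjoint qbt).
Local Notation gamma := (gamma_field T Gam0).
Local Notation weyl := (weyl T Gam0 Gam1).
Implicit Types (u v f : H) (g h : G) (z w nu : R[i]) (l s : R).

Section Equivalences.
Variables (E : set R -> {linear H -> H}).
Hypothesis hE : spectral_measure ipH A E.

Lemma weyl_characterization (Delta : set R) l : open Delta ->
  (forall u, E Delta u = u -> (forall nu g, complex.Im nu != 0 -> op_ran Gam0 g ->
    ipH u (gamma nu g) = 0) -> u = 0) -> Delta l ->
  (resolvent_set A l%:C <-> weyl_continuable T Gam0 Gam1 l) /\
  (continuous_spectrum A l%:C <->
    weyl_slim0 T Gam0 Gam1 l /\ ~ weyl_continuable T Gam0 Gam1 l).
Proof.
move=> oD DE Dl.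
have i1 := resolvent_continuable ipH_norm ipG_norm qbt (l := l).
have i2 := continuable_resolvent ipH_norm ipG_norm qbt hE oD DE Dl.
split; first by split.
split=> [[rl pl]|[sl nl]].
  split; [exact: (noneigenvalue_slim0 ipH_norm ipG_norm qbt)|by move=> /i2].
by split; [by move=> /i1|exact: (slim0_not_eigenvalue ipH_norm ipG_norm qbt hE oD DE Dl)].
Qed.

Lemma clsp_simple (Delta : set R) : open Delta ->
  range (E Delta) = clsp [set E Delta (gamma nu g)
    | nu in [set nu | complex.Im nu != 0] & g in op_ran Gam0] ->
  forall u, E Delta u = u -> (forall nu g, complex.Im nu != 0 -> op_ran Gam0 g ->
    ipH u (gamma nu g) = 0) -> u = 0.
Proof.
move=> oD DE u Du uperp; have mD : measurable (Delta : set (measurableTypeR R)).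
  exact: open_measurable.
have : range (E Delta) u by exists u.
rewrite DE => uc; apply: (ip_self0 ipH_norm); apply: (closure_orth ipH_norm uc).
move=> _ [n [c [x [xX ->]]]]; rewrite (raddf_sum (ipH u)) big1// => k _.
rewrite [LHS](ipZr ipH); have [nu nu0 [g rg <-]] := xX k.
by rewrite -(E_sym hE)// Du uperp// mulr0.
Qed.

End Equivalences.

(** * The complement of all gamma(nu) g reduces S to a selfadjoint operator *)

Section Reducing.
Hypothesis S_closed : closed (op_graph S).
Hypothesis S_dense : dense (op_dom S).
Hypothesis S_symm : symmetric_op ipH S.

Lemma symm_S u v : op_dom S u -> op_dom S v -> ipH (S u) v = ipH u (S v).
Proof. by move=> Su Sv; have /S_symm : op_graph S (v, S v) by []; exact. Qed.

Lemma S_T u v : op_dom S u -> op_dom T v -> ipH (S u) v = ipH u (T v).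
Proof. by move=> Su Tv; have /(qbt_sub qbt) : op_graph T (v, T v) by []; exact. Qed.

(** A_0 is contained in T, hence in the adjoint of S. Taking adjoints reverses the inclusion and
    leaves A_0 fixed. *)
Lemma S_sub_A u : op_dom S u -> op_dom A u /\ A u = S u.
Proof.
move=> Su; apply: (sa_adj sA) => v [Tv _].
by rewrite -[A v]/(T v) ipC -S_T// -ipC.
Qed.

Let L : set H := [set f | forall nu g, complex.Im nu != 0 -> op_ran Gam0 g ->
  ipH f (gamma nu g) = 0].

Let subL : linear_subspace L.
Proof.
split=> [nu g _ _|a u v Lu Lv nu g nu0 rg]; first exact: ip0l.
by rewrite ipDl ipZl Lu// Lv// mulr0 addr0.
Qed.

Let closedL : closed L.
Proof.
move=> f Lf nu g nu0 rg; apply: ip_eq0C; apply: (closure_orth ipH_norm Lf).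
by move=> w Lw; apply/ip_eq0C/Lw.
Qed.

Let nonreal_rho nu : complex.Im nu != 0 -> resolvent_set A nu.
Proof. exact: (nonreal_resolvent ipH_norm sA). Qed.

Let nonreal_conj nu : complex.Im nu != 0 -> complex.Im (Num.conj nu) != 0.
Proof. by rewrite conjCE/= oppr_eq0. Qed.

(* Gam1 R(nu) f = 0 puts R(nu) f in dom S** = dom S; the second adjoint is
   avoided by solving (S - nu) s = f, the range of S - nu being closed and equal
   to the orthogonal complement of ker (S* - conj nu). *)
Let resolv_dom nu f : complex.Im nu != 0 -> L f ->
  op_dom S (resolv A nu f) /\ S (resolv A nu f) - nu *: resolv A nu f = f.
Proof.
move=> nu0 Lf; have rnu := nonreal_rho nu0.
set u := resolv A nu f; have [Au uf] := resolv_spec f rnu.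
have [Tu u0] := (dom_A0P qbt u).1 Au.
have G1u : Gam1 u = 0.
  apply: (ip_dense0 ipG_norm (ran_dense qbt)) => h rh.
  by rewrite (gam1_resolv ipH_norm qbt)// Lf// nonreal_conj.
have Tu' v : op_dom T v -> ipH (T v) u = ipH v (T u).
  move=> Tv; apply: subr0_eq; rewrite (qbt_green qbt Tv Tu).
  by rewrite u0 G1u !ip0r subrr.
(* The symmetry relation with u passes from T to the adjoint of S, whose graph is the closure of the
   graph of T. *)
have adjT x y : adjoint ipH S (x, y) -> ipH y u = ipH x (T u).
  rewrite -(qbt_closure qbt) => /closure_prodP xy.
  apply: subr0_eq; suff re0 a : rip ipH (a *: y) u = rip ipH (a *: x) (T u).
    have := re0 1; have := re0 'i%C; rewrite !scale1r /rip !ipZl.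
    case: (ipH y u) => a b; case: (ipH x _) => c d /=.
    rewrite !mul0r !mul1r !sub0r => /oppr_inj -> ->.
    by rewrite subrr.
  apply/eqP; rewrite -subr_eq0 -normr_le0; apply/ler_addgt0Pr => e e0; rewrite add0r.
  pose c : R := cabs a * (rnorm u + rnorm (T u)) + 1.
  have a0 := cabs_ge0 a; have nu1 := rnorm_ge0 u; have ntu := rnorm_ge0 (T u).
  have c0 : 0 < c by rewrite ltr_wpDl// mulr_ge0// addr_ge0.
  have [[v w] [/= [/= Tv vw]]] := xy _ (divr_gt0 e0 c0).
  rewrite !ltr_pdivlMr// -vw => xv yv.
  have vT : rip ipH (a *: T v) u = rip ipH (a *: v) (T u).
    by rewrite /rip !ipZl Tu'.
  have -> : rip ipH (a *: y) u - rip ipH (a *: x) (T u) =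
      rip ipH (a *: (y - T v)) u - rip ipH (a *: (x - v)) (T u).
    by rewrite !scalerBr !ripBl vT; ring.
  have h1 := normr_rip_le ipH_norm (a *: (y - T v)) u.
  have h2 := normr_rip_le ipH_norm (a *: (x - v)) (T u).
  rewrite !rnormZ in h1 h2; apply: le_trans (ler_normB _ _) _.
  have h3 := rnorm_ge0 (y - T v); have h4 := rnorm_ge0 (x - v).
  apply: le_trans (lerD h1 h2) _.
  have c1 : 1 <= c by rewrite /c lerDr mulr_ge0// addr_ge0.
  have h5 : rnorm (y - T v) <= e / c by rewrite ler_pdivlMr// ltW.
  have h6 : rnorm (x - v) <= e / c by rewrite ler_pdivlMr// ltW.
  have h7 : cabs a * rnorm (y - T v) * rnorm u <= cabs a * (e / c) * rnorm u.
    by rewrite ler_wpM2r// ler_wpM2l.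
  have h8 : cabs a * rnorm (x - v) * rnorm (T u) <= cabs a * (e / c) * rnorm (T u).
    by rewrite ler_wpM2r// ler_wpM2l.
  apply: le_trans (lerD h7 h8) _.
  have q0 : 0 <= e / c by rewrite ltW// divr_gt0.
  have : e / c * c = e by rewrite divfK// gt_eqF.
  move: q0; move: (e / c) => q q0; rewrite /c => <-.
  by lra.
have Sgc := closed_graph_closed S_closed.
have Sb : bounded_below S nu `|complex.Im nu|.
  by apply: (nonreal_bounded_below ipH_norm) => v Sv; exact: symm_S.
have nup : 0 < `|complex.Im nu| by rewrite normr_gt0.
have [s Ss sf] : op_ran (op_shift S nu) f.
  have [p [s Ss sp] fp] := projection ipH_norm f (range_subspace (op_shift S nu))
    (closed_range Sgc nup Sb).
  suff fp0 : f - p = 0 by rewrite (subr0_eq fp0); exists s.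
  (* The defect f - p is an eigenvector of the adjoint of S at conj nu. Pairing it with u by [adjT]
     gives (f - p, (T - nu) u) = (f - p, f) = 0. *)
  have adj : adjoint ipH S (f - p, Num.conj nu *: (f - p)).
    move=> v Sv /=; rewrite ipZr conjCK -ipZl; apply: subr0_eq; rewrite -ipBl.
    by apply: ip_eq0C; apply: fp; exists v.
  have := adjT _ _ adj; rewrite ipZl => h.
  have fpf : ipH (f - p) f = 0.
    by rewrite -[X in ipH _ X]uf ipBr ipZr h subrr.
  have fpp : ipH (f - p) p = 0 by apply: fp; exists s.
  by apply: (ip_self0 ipH_norm); rewrite ipBr fpf fpp subrr.
have [As Ase] := S_sub_A Ss.
have -> : u = s by apply/esym/(resolv_unique ipH_norm sA rnu); rewrite ?Ase.
by split.
Qed.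

(** gamma(.) g is continuous off the real axis, so one excluded point is recovered as a limit. It is
    needed in [resolv_L], where one point yields no information. *)
Let L_of_nonconj u nu : (forall w g, complex.Im w != 0 -> w != nu -> op_ran Gam0 g ->
  ipH u (gamma w g) = 0) -> L u.
Proof.
move=> h w g w0 rg; have [wnu|] := eqVneq w nu; last by move=> wnu; exact: h.
apply: ip_orth => a; apply/eqP; rewrite -normr_le0; apply/ler_addgt0Pr => e e0.
rewrite add0r; pose K : R := rnorm u * (cabs a * (rnorm (gamma w g) / `|complex.Im w|)) + 1.
have p0 : 0 <= rnorm (gamma w g) / `|complex.Im w| by rewrite divr_ge0// rnorm_ge0.
have K0 : 0 < K by rewrite ltr_wpDl// !mulr_ge0// ?rnorm_ge0// cabs_ge0.
(* The shift is horizontal, so Im w' = Im w and the resolvent bound does not depend on its size. *)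
pose w' := w - (e / K)%:C.
have w'0 : complex.Im w' != 0 by rewrite /w' raddfB/= subr0.
have rw := nonreal_rho w0; have rw' := nonreal_rho w'0.
have eK : 0 < e / K by rewrite divr_gt0.
have w'nu : w' != nu.
  by rewrite /w' wnu subr_eq addrC -subr_eq subrr eq_sym eq_complex/= negb_and gt_eqF.
have : rip ipH u (a *: gamma w g) = rip ipH u (a *: (gamma w g - gamma w' g)).
  by rewrite scalerBr ripBr [X in _ - X]ip0P ?subr0// ipZr h// mulr0.
move=> ->; apply: le_trans (normr_rip_le ipH_norm _ _) _.
rewrite (gamma_diff ipH_norm qbt)// /w' opprB addrC subrK !rnormZ cabsR gtr0_norm//.
set r := resolv _ _ _.
have hr : rnorm r <= rnorm (gamma w g) / `|complex.Im w|.
  rewrite ler_pdivlMr ?normr_gt0// mulrC.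
  have [Ar rf] := resolv_spec (gamma w g) rw'; rewrite -[X in _ <= rnorm X]rf.
  have -> : complex.Im w = complex.Im w' by rewrite /w' raddfB/= subr0.
  by apply: (nonreal_bounded_below ipH_norm) => // v Av; exact: (sa_symm sA).
apply: (@le_trans _ _ (e / K * (K - 1))); last first.
  by rewrite mulrBr mulr1 divfK ?gt_eqF// gerBl ltW.
have -> : K - 1 = rnorm u * (cabs a * (rnorm (gamma w g) / `|complex.Im w|)) by rewrite /K addrK.
have q0 : 0 <= rnorm u * cabs a * (e / K).
  by rewrite mulr_ge0 ?(ltW eK)// mulr_ge0 ?rnorm_ge0 ?cabs_ge0.
by have := ler_wpM2l q0 hr; lra.
Qed.

(** Pairing f = (S - nu) R(nu) f with gamma(w) g gives (conj w - nu) (R(nu) f, gamma(w) g) = 0,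
    decisive except at w = conj nu. *)
Let resolv_L nu f : complex.Im nu != 0 -> L f -> L (resolv A nu f).
Proof.
move=> nu0 Lf; have [Su Suf] := resolv_dom nu0 Lf.
apply: (@L_of_nonconj _ (Num.conj nu)) => w g w0 wnu rg.
have [g1 g2 g3] := gamma_spec ipH_norm qbt (nonreal_rho w0) rg.
have : ipH (S (resolv A nu f) - nu *: resolv A nu f) (gamma w g) = 0 by rewrite Suf Lf.
rewrite ipBl S_T// g2 ipZr ipZl -mulrBl => /eqP.
rewrite mulf_eq0 => /orP[|/eqP//]; rewrite subr_eq0 => /eqP wn.
by move: wnu; rewrite -wn conjCK eqxx.
Qed.

Let L_inv u : op_dom S u -> L u -> L (S u).
Proof.
move=> Su Lu nu g nu0 rg.
have [g1 g2 g3] := gamma_spec ipH_norm qbt (nonreal_rho nu0) rg.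
by rewrite S_T// g2 ipZr Lu// mulr0.
Qed.

Let i0 : complex.Im ('i%C : R[i]) != 0. Proof. by rewrite /= oner_eq0. Qed.

(** If p is the projection of (S - i) u on L, then R(i) p is the projection of u. For w in L, moving
    A_0 - i across gives (u - R(i) p, w) = (f - p, R(- i) w) = 0, because L is invariant under R(-
    i). *)
Let reducesL : reduces ipH L S.
Proof.
move=> u v Su [Lv uv].
have [Au AuS] := S_sub_A Su; pose i := 'i%C : R[i].
pose f := S u - i *: u.
have [p Lp fp] := projection ipH_norm f subL closedL.
have [Sv' vp] := resolv_dom i0 Lp; have Lv' := resolv_L i0 Lp.
have ri := nonreal_rho i0.
have uv' (w : H) : L w -> ipH (u - resolv A i p) w = 0.
  move=> Lw; have Ar := (resolv_spec p ri).1; have rp := (resolv_spec p ri).2.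
  have Aur : op_dom A (u - resolv A i p) by exact: op_domB.
  have [B1 B2] := resolv_spec w (nonreal_rho (nonreal_conj i0)).
  rewrite -B2 ipBr ipZr conjCK -ipZl -(sa_symm sA)//.
  rewrite -ipBl opB// scalerBr subrACA rp AuS fp//.
  by apply: resolv_L; first exact: nonreal_conj.
have vE : v = resolv A i p.
  have Ld : L (v - resolv A i p) := subspaceB subL Lv Lv'.
  have e : u - resolv A i p - (u - v) = v - resolv A i p.
    by rewrite opprB addrC addrA subrK.
  apply: subr0_eq; apply: (ip_self0 ipH_norm).
  by rewrite -[X in ipH X _]e ipBl uv'// uv// subrr.
rewrite vE; split=> //; split; first exact: L_inv.
move=> w Lw; have -> : S u - S (resolv A i p) = (f - p) + i *: (u - resolv A i p).
  have -> : S (resolv A i p) = p + i *: resolv A i p by rewrite -{2}vp subrK.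
  by rewrite /f scalerBr [_ - _ - p]addrAC [RHS]addrA subrK opprD addrA.
by rewrite ipDl ipZl uv'// fp// mulr0 addr0.
Qed.

Let selfadjointL : selfadjoint_in ipH L (op_restrict S subL).
Proof.
split=> [u []//|_ [u [Su Lu] <-]|f Lf|]; first exact: L_inv.
  apply/closure_rnormP => e e0; have [u Su fu] := (dense_rnormP _).1 S_dense f e e0.
  have [p Lp up] := projection ipH_norm u subL closedL.
  have [Sp _] := reducesL Su (conj Lp up).
  exists p => //; apply: le_lt_trans fu.
  rewrite -ler_sqr ?nnegrE ?rnorm_ge0//.
  have -> : f - u = (f - p) - (u - p) by rewrite opprB addrA subrK.
  (* Projecting on L does not increase the distance to f, as f - p in L is orthogonal to u - p. *)
  rewrite (rnormB2 ipH_norm (f - p)) (ripC ipH).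
  rewrite (ip0P (up _ (subspaceB subL Lf Lp))).
  by rewrite mulr0 subr0 lerDl sqr_ge0.
apply/seteqP; split=> [[x y] [/= xy [Lx Ly]]|[x y] [/= [Sx Lx] <-]]; last first.
  split; last by split=> //; exact: L_inv.
  by move=> u [Su Lu] /=; exact: symm_S.
pose i := 'i%C : R[i].
have Lf : L (y - i *: x) := subspaceB subL Ly (subspaceZ i subL Lx).
have [Ss sf] := resolv_dom i0 Lf; have Ls := resolv_L i0 Lf.
set s := resolv _ _ _ in Ss sf Ls.
have Ld : L (x - s) := subspaceB subL Lx Ls.
have ni0 := nonreal_conj i0.
(* With d = x - s and r = R(- i) d, which lies in L and in dom S, one gets (d, d) = ((S + i) r, d) =
   (r, y - S s - i d) = 0, so x = s is in dom S. *)
have [Sr rd] := resolv_dom ni0 Ld; have Lr := resolv_L ni0 Ld.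
set r := resolv _ _ _ in Sr rd Lr.
suff d0 : x - s = 0.
  rewrite /op_graph /= (subr0_eq d0); split=> //.
  by apply: (addIr (- (i *: s))); rewrite sf (subr0_eq d0).
apply: (ip_self0 ipH_norm); rewrite -{1}rd ipBl ipZl -[Num.conj i * _]ipZr.
have := xy r (conj Sr Lr); rewrite /= => xr.
rewrite ipBr xr symm_S// -!ipBr.
suff -> : y - S s - i *: (x - s) = 0 by rewrite ip0r.
by rewrite scalerBr subrACA sf subrr.
Qed.

Lemma simple_total u : simple_op ipH S ->
  (forall nu g, complex.Im nu != 0 -> op_ran Gam0 g -> ipH u (gamma nu g) = 0) -> u = 0.
Proof.
move=> simpleS uperp; have : L u by [].
by rewrite (simpleS L subL closedL L_inv reducesL selfadjointL).
Qed.

End Reducing.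

End SimpleOperator.

Theorem theorem3p5 (R : realType) (H G : completeNormedModType R[i])
  (ipH : {dot H for Num.conj}) (ipG : {dot G for Num.conj})
  (ipH_norm : forall u : H, `|u| ^+ 2 = ipH u u)
  (ipG_norm : forall g : G, `|g| ^+ 2 = ipG g g)
  (sepH : separable_space H)
  (S T : linop H H) (Gam0 Gam1 : linop H G)
  (S_closed : closed (op_graph S)) (S_dense : dense (op_dom S))
  (S_symm : symmetric_op ipH S)
  (qbt : quasi_boundary_triple ipH ipG S T Gam0 Gam1)
  (E : set R -> {linear H -> H})
  (E_spectral : spectral_measure ipH (A_0 T Gam0) E) :
  (forall Delta : set R, open Delta -> is_interval Delta ->
    range (E Delta) =
      clsp [set E Delta (gamma_field T Gam0 nu g)
           | nu in [set nu | complex.Im nu != 0] & g in op_ran Gam0] ->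
    forall l : R, Delta l ->
      (resolvent_set (A_0 T Gam0) l%:C <-> weyl_continuable T Gam0 Gam1 l) /\
      (continuous_spectrum (A_0 T Gam0) l%:C <->
        weyl_slim0 T Gam0 Gam1 l /\ ~ weyl_continuable T Gam0 Gam1 l)) /\
  (simple_op ipH S ->
    forall l : R,
      (resolvent_set (A_0 T Gam0) l%:C <-> weyl_continuable T Gam0 Gam1 l) /\
      (continuous_spectrum (A_0 T Gam0) l%:C <->
        weyl_slim0 T Gam0 Gam1 l /\ ~ weyl_continuable T Gam0 Gam1 l)).
Proof.
split=> [Delta oD _ DE l Dl|simpleS l].
  apply: (weyl_characterization ipH_norm ipG_norm qbt E_spectral oD _ Dl).
  exact: (clsp_simple ipH_norm E_spectral oD DE).
apply: (weyl_characterization ipH_norm ipG_norm qbt E_spectral openT) => // u _.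
exact: (simple_total ipH_norm ipG_norm qbt S_closed S_dense S_symm simpleS).
Qed.
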